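(* Let $R$ be a finite ring, not necessarily commutative, let $\Bbbk$ be a left Noetherian ring, and let $M$ be a finitely generated $\mathrm{VIC}(R)$-module over $\Bbbk$. Then for every $p\ge 0$ there is an isomorphism \[\mathrm{H}_p(\mathrm{GL}_n(R);M_n)\cong \mathrm{H}_p(\mathrm{GL}_{n+1}(R);M_{n+1})\] for all $n$ sufficiently large (depending on $p$).
   Context: Modules $R^n$ are column vectors regarded as right $R$-modules; $\mathrm{GL}_n(R)$ acts on $R^n$ on the left. Write $[R^n]$ for $R^n$ regarded as an object. The category $\mathrm{VIC}(R)$ has objects $[R^n]$, $n\ge0$; a morphism $[R^n]\to[R^m]$ is a pair $(f',f'')$ with $f'\colon R^n\to R^m$ injective $R$-linear and $f''\colon R^m\to R^n$ $R$-linear with $f''\circ f'=\mathrm{id}$; composition is $(g',g'')\circ(f',f'')=(g'\circ f', f''\circ g'')$. A $\mathrm{VIC}(R)$-module over $\Bbbk$ is a functor from $\mathrm{VIC}(R)$ to $\Bbbk$-modules; it is finitely generated if there are finitely many objects $[R^{d_i}]$ and elements $x_i\in M([R^{d_i}])$ such that the smallest submodule containing all $x_i$ is $M$. Write $M_n=M([R^n])$. The endomorphisms of $[R^n]$ in $\mathrm{VIC}(R)$ are the pairs $(\phi,\phi^{-1})$ with $\phi\in\mathrm{GL}_n(R)$, so $M_n$ is a $\Bbbk[\mathrm{GL}_n(R)]$-module, and $\mathrm{H}_p(\mathrm{GL}_n(R);M_n)$ denotes group homology with these coefficients. *)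

(* Defs.v *)
From HB Require Import structures.
From mathcomp Require Import all_boot all_order all_algebra.
Set Implicit Arguments. Unset Strict Implicit. Unset Printing Implicit Defensive.
Import GRing.Theory.
Local Open Scope ring_scope.

Definition left_ideal (k : pzRingType) (I : k -> Prop) : Prop :=
  [/\ I 0, (forall x y, I x -> I y -> I (x + y)) & (forall r x, I x -> I (r * x))].

Definition left_noetherian (k : pzRingType) : Prop :=
  forall I : k -> Prop, left_ideal I ->
    exists s : seq k, forall x, I x <->
      exists r : 'I_(size s) -> k, x = \sum_(i < size s) r i * s`_i.

(* A morphism [R^m] -> [R^n] is a pair (f', f'') with f' : R^m -> R^n given by an
   n x m matrix (acting on column vectors), f'' : R^n -> R^m an m x n matrix, and
   f'' * f' = 1.  (Injectivity of f' follows.)  Composition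
   (g',g'') o (f',f'') = (g' f', f'' g'').  The action map [act] is given on all pairs
   of matrices, but all axioms only concern genuine morphisms. *)
Definition is_VICmor (R : finPzRingType) m n (f : 'M[R]_(n, m)) (g : 'M[R]_(m, n)) :=
  g *m f = 1%:M.

Record VICmodule (R : finPzRingType) (k : pzRingType) := {
  obj : nat -> lmodType k;
  act : forall m n, 'M[R]_(n, m) -> 'M[R]_(m, n) -> obj m -> obj n;
  act_linear : forall m n (f : 'M[R]_(n, m)) g, is_VICmor f g ->
    forall (a : k) (x y : obj m), act f g (a *: x + y) = a *: act f g x + act f g y;
  act_id : forall n (x : obj n), act (1%:M : 'M[R]_n) 1%:M x = x;
  act_comp : forall m n p (f : 'M[R]_(n, m)) g (f2 : 'M[R]_(p, n)) g2,
    is_VICmor f g -> is_VICmor f2 g2 ->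
    forall x : obj m, act (f2 *m f) (g *m g2) x = act f2 g2 (act f g x)
}.

Definition VICsubmodule R k (M : VICmodule R k) (N : forall n, obj M n -> Prop) :=
  [/\ forall n, N n 0,
      forall n (a : k) (x y : obj M n), N n x -> N n y -> N n (a *: x + y)
    & forall m n (f : 'M[R]_(n, m)) g (x : obj M m), is_VICmor f g ->
        N m x -> N n (@act R k M m n f g x)].

Definition VIC_fg R k (M : VICmodule R k) : Prop :=
  exists (l : nat) (d : 'I_l -> nat) (x : forall i : 'I_l, obj M (d i)),
    forall N, VICsubmodule N -> (forall i, N (d i) (x i)) ->
      forall n (y : obj M n), N n y.

Definition GLpred (R : finPzRingType) n (AB : 'M[R]_n * 'M[R]_n) : bool :=
  (AB.1 *m AB.2 == 1%:M) && (AB.2 *m AB.1 == 1%:M).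

Definition GL (R : finPzRingType) n := {AB : 'M[R]_n * 'M[R]_n | GLpred AB}.

Lemma GLpred1 (R : finPzRingType) n : GLpred ((1%:M : 'M[R]_n), (1%:M : 'M[R]_n)).
Proof. by rewrite /GLpred /= mul1mx eqxx. Qed.

Lemma GLpredM (R : finPzRingType) n (g h : GL R n) :
  GLpred ((val g).1 *m (val h).1, (val h).2 *m (val g).2).
Proof.
case: g => [[A B] /= /andP[/eqP AB /eqP BA]]; case: h => [[C D] /= /andP[/eqP CD /eqP DC]].
rewrite /GLpred /= -!mulmxA (mulmxA C) (mulmxA B) CD BA mul1mx AB.
by rewrite mul1mx DC !eqxx.
Qed.

Definition GL1 (R : finPzRingType) n : GL R n := exist (fun AB => GLpred AB) _ (GLpred1 R n).
Definition GLmul (R : finPzRingType) n (g h : GL R n) : GL R n :=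
  exist (fun AB => GLpred AB) _ (GLpredM g h).

Definition GLact R k (M : VICmodule R k) n (g : GL R n) (x : obj M n) : obj M n :=
  @act R k M n n (val g).1 (val g).2 x.
Definition GLact_inv R k (M : VICmodule R k) n (g : GL R n) (x : obj M n) : obj M n :=
  @act R k M n n (val g).2 (val g).1 x.

(* C_p = functions from G^p to M_n, representing sum_t [t] (x) c(t).
   With the right action m.g := g^-1 m, the boundary is
   d([g1|..|gp] (x) m) = [g2|..|gp] (x) g1^-1 m
       + sum_{i=1}^{p-1} (-1)^i [..|g_i g_{i+1}|..] (x) m + (-1)^p [g1|..|g_{p-1}] (x) m. *)
Section Bar.
Variables (R : finPzRingType) (k : pzRingType) (M : VICmodule R k).

Definition gt n q (t : {ffun 'I_q -> GL R n}) (j : nat) : GL R n :=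
  oapp t (GL1 R n) (insub j).

Definition face n p (i : nat) (t : {ffun 'I_p.+1 -> GL R n}) : {ffun 'I_p -> GL R n} :=
  [ffun j : 'I_p => if (j.+1 < i)%N then gt t j
                    else if (j.+1 == i)%N then GLmul (gt t j) (gt t j.+1)
                    else gt t j.+1].

Definition chain n p := {ffun 'I_p -> GL R n} -> obj M n.

Definition bnd n p (c : chain n p.+1) : chain n p := fun s =>
  \sum_(i < p.+2) \sum_(t | face i t == s)
     ((-1) ^+ i : k) *: (if i == 0%N :> nat then @GLact_inv R k M n (gt t 0) (c t) else c t).

Definition is_cycle n p : chain n p -> Prop :=
  match p return chain n p -> Prop with
  | 0 => fun _ => True
  | q.+1 => fun c => forall s, bnd c s = 0
  end.

Definition is_boundary n p (c : chain n p) : Prop :=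
  exists b : chain n p.+1, forall s, bnd b s = c s.

(* H_p(GL_n(R); M_n) ~= H_p(GL_m(R); M_m) as k-modules, written out on
   cycles / boundaries: a k-linear map of cycle modules preserving boundaries
   and inducing a bijection on the quotients. *)
Definition homology_iso p n m : Prop :=
  exists f : chain n p -> chain m p,
  [/\ forall z, is_cycle z -> is_cycle (f z),
      forall (a : k) z1 z2, is_cycle z1 -> is_cycle z2 ->
        forall s, f (fun t => a *: z1 t + z2 t) s = a *: f z1 s + f z2 s,
      forall z, is_cycle z -> is_boundary z -> is_boundary (f z),
      forall z, is_cycle z -> is_boundary (f z) -> is_boundary z
    & forall z', is_cycle z' -> exists2 z, is_cycle z &
        is_boundary (fun s => z' s - f z s)].
End Bar.

(* Main.v *)
(** Write a morphism [R^d] -> [R^n] as a word of length n whose letters pair the i-th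
row of the injection with the i-th column of its left inverse.  Higman's lemma for
such words, together with leading coefficients for a suitable lexicographic order,
shows that submodules of finitely generated free VIC(R)-modules are finitely
generated.

Stability is then proved by induction on p, for all finitely generated M at once.
If M is generated in degree at most d, then in degrees above d it is covered by a
free module P generated in degree d+1, through elements that come from degree d.
The kernel of P -> M is finitely generated, so the long exact sequence and the case
p-1 reduce the surjectivity of H_p(GL_n; M_n) -> H_p(GL_(n+1); M_(n+1)) to classes
in the image of H_p(GL_(n+1); P_(n+1)).  Conjugating the additional basis vector of
a morphism [R^(d+1)] -> [R^(n+1)] onto a fixed coordinate moves such a class into
GL_n: the stabilizer of the morphism fixes that coordinate, and its value in M does
not involve it.
Finally surjectivity for all large n forces injectivity for all large n, by the
ascending chain condition on the kernels of the iterated stabilization maps.  Only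
the pigeonhole principle is needed to bring words into normal form when n is large. *)

From HB Require Import structures.
Require Import Defs.
From mathcomp Require Import all_boot all_order all_algebra fingroup boolp.
Set Implicit Arguments. Unset Strict Implicit. Unset Printing Implicit Defensive.
Import GRing.Theory.

(** * Higman's lemma over a finite alphabet *)

Lemma incr_homo (g : nat -> nat) :
  (forall i, g i < g i.+1)%N -> {homo g : i j / (i < j)%N}.
Proof.
move=> gS i; elim=> // j IHj; rewrite ltnS leq_eqVlt => /predU1P[->//|/IHj].
by move/ltn_trans; apply.
Qed.

Lemma infinitely_often (P : nat -> Prop) :
  (forall N, exists2 n, (N <= n)%N & P n) ->
  exists2 g : nat -> nat, {homo g : i j / (i < j)%N} & forall i, P (g i).
Proof.
move=> hP; have /choice[f hf] : forall N, exists n, (N <= n)%N /\ P n.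
  by move=> N; have [n] := hP N; exists n.
pose g i := iter i (fun m => f m.+1) (f 0).
exists g; last by case=> [|i]; [have [] := hf 0 | have [] := hf (g i).+1].
by apply: incr_homo => i; rewrite /g iterS; case: (hf (g i).+1).
Qed.

(** * Ascending subsequences of words over a finite alphabet *)

Section Higman.
Variable T : finType.

(** Infinite ascending subsequences are asked for, rather than one comparable pair, because
    selections are made one after another. *)
Definition ascending_in (P : seq T -> Prop) :=
  forall u : nat -> seq T, (forall i, P (u i)) ->
  exists2 g : nat -> nat, {homo g : i j / (i < j)%N}
    & forall i j, (i < j)%N -> subseq (u (g i)) (u (g j)).

Lemma ascending_infinitely_often (P : seq T -> Prop) (u : nat -> seq T) :
  ascending_in P -> (forall N, exists2 n, (N <= n)%N & P (u n)) ->
  exists2 g : nat -> nat, {homo g : i j / (i < j)%N}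
    & forall i j, (i < j)%N -> subseq (u (g i)) (u (g j)).
Proof.
move=> aP /infinitely_often[g g_incr /aP[h h_incr hs]].
by exists (g \o h) => // i j /h_incr /g_incr.
Qed.

(** Induction on [w], with first letter [a]. Either infinitely many words lack [a], and the smaller
    alphabet applies; or almost all words split at their first [a], with a left part free of [a] and
    a right part avoiding the rest of [w]. Two successive selections then make both parts ascend. *)
Lemma ascending_avoiding (A : {set T}) (w : seq T) :
  (forall a, a \in A -> ascending_in (fun s => {subset s <= A :\ a})) ->
  {subset w <= A} ->
  ascending_in (fun s => {subset s <= A} /\ ~~ subseq w s).
Proof.
move=> aA; elim: w => [_ u /(_ 0) [_]|a w IHw wA u uP]; first by rewrite sub0seq.
have aAA : a \in A by apply: wA; rewrite mem_head.
have [hfree|] := EM (forall N, exists2 n, (N <= n)%N & a \notin u n).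
  apply: (ascending_infinitely_often (aA a aAA)) => //.
  move=> N; have [n Nn an] := hfree N; exists n => // x xs.
  by rewrite !inE (uP n).1 // andbT; apply: contraNneq an => <-.
move=> /existsNP[N hN].
have hin n : a \in u (N + n)%N.
  apply: contrapT => /negP an; apply: hN; exists (N + n)%N => //; exact: leq_addr.
pose l n := take (index a (u (N + n)%N)) (u (N + n)%N).
pose r n := drop (index a (u (N + n)%N)).+1 (u (N + n)%N).
have dec n : u (N + n)%N = l n ++ a :: r n.
  by rewrite /l /r -{2}(nth_index a (hin n)) -drop_nth ?cat_take_drop // index_mem.
have [n|g gi gs] := aA a aAA l.
  move=> x xl; rewrite !inE (uP (N + n)%N).1 ?(mem_take xl) // andbT.
  apply: contraTneq xl => ->; rewrite /l; apply/negP => /index_ltn.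
  by rewrite ltnn.
have [||h hi hs] := IHw _ (r \o g).
- by move=> x xw; apply: wA; rewrite inE xw orbT.
- move=> n /=; have [uA] := uP (N + g n)%N; rewrite dec => nsub; split.
    by move=> x xr; apply: uA; rewrite dec mem_cat inE xr !orbT.
  apply: contra nsub => wr; apply: (@cat_subseq _ [::] (a :: w)); first exact: sub0seq.
  by rewrite /= eqxx.
exists (fun n => (N + g (h n))%N); first by move=> i j /hi/gi; rewrite ltn_add2l.
move=> i j ij; rewrite !dec; apply: cat_subseq; first exact/gs/hi.
by rewrite /= eqxx; apply: hs.
Qed.

(** Induction on the size of the alphabet. Either some [u i] fails to embed in infinitely many
    words, and those words avoid it; or every [u i] embeds in all late words, and a subsequence can
    be chosen greedily. *)
Lemma higman_on (A : {set T}) : ascending_in (fun s => {subset s <= A}).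
Proof.
have [m] := ubnP #|A|; elim: m A => // m IHm A cA u uA.
have aA a : a \in A -> ascending_in (fun s => {subset s <= A :\ a}).
  by move=> aA; apply: IHm; rewrite (cardsD1 a) aA add1n in cA.
have [[i hi]|ev] := EM (exists i, forall N, exists2 n, (N <= n)%N & ~~ subseq (u i) (u n)).
  have [|g] := ascending_infinitely_often (u := u) (ascending_avoiding aA (uA i)).
    by move=> N; have [n Nn an] := hi N; exists n.
  by move=> gi gs; exists g.
have /choice[J hJ] : forall i, exists N, forall n, (N <= n)%N -> subseq (u i) (u n).
  move=> i; apply: contrapT => /forallNP hN; apply: ev; exists i => N.
  have /existsNP[n /not_implyP[Nn /negP an]] := hN N; by exists n.
pose g i := iter i (fun m => maxn m.+1 (J m)) 0.
have gi : {homo g : i j / (i < j)%N}.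
  by apply: incr_homo => i; rewrite /g iterS leq_maxl.
exists g => // i j; elim: j => // j IHj; rewrite ltnS leq_eqVlt => ij.
have sj : subseq (u (g j)) (u (g j.+1)) by apply: hJ; rewrite /g iterS leq_maxr.
by case/predU1P: ij => [->//|/IHj]; move/subseq_trans; apply.
Qed.

Theorem higman (u : nat -> seq T) :
  exists2 g : nat -> nat, {homo g : i j / (i < j)%N}
    & forall i j, (i < j)%N -> subseq (u (g i)) (u (g j)).
Proof. by apply: (@higman_on setT) => i x _; rewrite inE. Qed.

End Higman.

Lemma subseq_embedding (T : eqType) (x0 : T) (s t : seq T) : subseq s t ->
  exists2 f : nat -> nat, {in gtn (size s) &, {homo f : i j / (i < j)%N}}
    & forall i, (i < size s)%N -> (f i < size t)%N /\ nth x0 t (f i) = nth x0 s i.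
Proof.
elim: t s => [|y t IHt] [|x s] //=.
- by exists id.
- by exists id.
case: eqP => [->|_] /IHt[f fi fs].
  exists (fun i => if i is j.+1 then (f j).+1 else 0) => [[|i] [|j] //|[|i] //].
    by move=> hi hj; rewrite !ltnS; apply: fi.
  by rewrite ltnS => /fs.
by exists (S \o f) => [i j hi hj ij|i /fs //]; rewrite ltnS; apply: fi.
Qed.
(** * Noetherianity of free VIC-modules *)

Section Lexicographic.

Local Notation lex := (seqlexi nat).

Lemma ltlex_cons (x y : nat) (s t : lex) :
  ((x :: s : lex) < (y :: t : lex))%O = (x < y)%N || (x == y) && (s < t)%O.
Proof. by rewrite ltxi_cons !leEnat; case: ltngtP. Qed.

Lemma ltlex_cat (s1 s2 t1 t2 : lex) : size s1 = size t1 ->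
  ((s1 ++ s2 : lex) < (t1 ++ t2 : lex))%O =
  (s1 < t1)%O || (s1 == t1) && (s2 < t2)%O.
Proof.
elim: s1 t1 => [|x s1 IHs] [|y t1] //= [/IHs].
rewrite !ltlex_cons eqseq_cons => ->.
by case: ltngtP.
Qed.

Definition first_less n (f g : 'I_n -> nat) :=
  exists2 i : 'I_n, forall j : 'I_n, (j < i)%N -> f j = g j & (f i < g i)%N.

Lemma codom_ordSl n (f : 'I_n.+1 -> nat) :
  codom f = f ord0 :: codom (f \o lift ord0).
Proof. by rewrite /codom /image_mem enum_ordSl /= -map_comp. Qed.

Lemma ltlex_codomP n (f g : 'I_n -> nat) :
  ((codom f : lex) < (codom g : lex))%O <-> first_less f g.
Proof.
elim: n f g => [|n IHn] f g.
  by split=> [|[[]//]]; rewrite /codom /image_mem enum_ord0 Order.POrderTheory.ltxx.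
rewrite !codom_ordSl ltlex_cons; split.
  case/orP=> [lt0|/andP[/eqP eq0 /IHn[i eqi lti]]]; first by exists ord0.
  exists (lift ord0 i) => // j; case: (unliftP ord0 j) => [j' ->|-> //].
  by move=> /(eqi j').
case=> i; case: (unliftP ord0 i) => [i' ->|-> _ ->//] eqi lti.
rewrite (eqi ord0) // eqxx /=; apply/orP; right; apply/IHn; exists i' => // j ji.
exact: eqi.
Qed.

Lemma eq_codomP n (f g : 'I_n -> nat) : codom f = codom g <-> f =1 g.
Proof.
split=> [/eq_in_map eqfg i|/eq_codom//]; by apply: eqfg; rewrite mem_enum.
Qed.

End Lexicographic.

Section Rank.
Context {d : Order.disp_t} {T : finType} {K : orderType d} (key : T -> K).

(** Turns a key into a natural number, on which induction can run. *)
Definition rank_by x := #|[set y | (key y < key x)%O]|.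

Lemma rank_byE x y : (rank_by x < rank_by y)%N = (key x < key y)%O.
Proof.
apply/idP/idP => [|xy].
  rewrite ltnNge; apply: contraNT; rewrite -Order.TotalTheory.leNgt => yx.
  by apply/subset_leq_card/subsetP => z; rewrite !inE => /Order.POrderTheory.lt_le_trans; apply.
apply/proper_card/properP; split.
  by apply/subsetP => z; rewrite !inE => /Order.POrderTheory.lt_trans; apply.
by exists x; rewrite !inE ?Order.POrderTheory.ltxx.
Qed.

Lemma rank_by_inj : injective key -> injective rank_by.
Proof.
move=> key_inj x y rxy; apply: key_inj; apply/eqP.
by case: Order.TotalTheory.ltgtP => //; rewrite -rank_byE rxy ltnn.
Qed.

End Rank.

Local Open Scope ring_scope.

(** * Words, their order, and insertion of letters *)

Section Words.
Variables (R : finPzRingType) (d : nat).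

Definition word n := ('M[R]_(n, d) * 'M[R]_(d, n))%type.

Definition word_act m n (f : 'M[R]_(n, m)) (g : 'M[R]_(m, n)) (w : word m) : word n :=
  (f *m w.1, w.2 *m g).

Definition pivot n (B : 'M[R]_(d, n)) (i : 'I_n) :=
  [forall j : 'I_n, (j < i)%N ==> (col j B != col i B)].

(** Marks the nonpivots whose row can be copied by later inserted letters; pivots serve in the same
    way for columns. *)
Definition new_row n (w : word n) (i : 'I_n) :=
  ~~ pivot w.2 i &&
  [forall j : 'I_n, (j < i)%N && ~~ pivot w.2 j ==> (row j w.1 != row i w.1)].

Lemma pivot_inj n (B : 'M[R]_(d, n)) i j :
  pivot B i -> pivot B j -> col i B = col j B -> i = j.
Proof.
move=> /forallP pi /forallP pj eqij; apply/val_inj/eqP.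
by case: ltngtP => // ij; [have := pj i | have := pi j]; rewrite ij eqij eqxx.
Qed.

Lemma new_row_inj n (w : word n) i j :
  new_row w i -> new_row w j -> row i w.1 = row j w.1 -> i = j.
Proof.
move=> /andP[npi /forallP pi] /andP[npj /forallP pj] eqij; apply/val_inj/eqP.
by case: ltngtP => // ij; [have := pj i | have := pi j]; rewrite ij ?npi ?npj eqij eqxx.
Qed.

Lemma pivot_exists n (B : 'M[R]_(d, n)) (j : 'I_n) :
  exists i : 'I_n, [/\ (i <= j)%N, pivot B i & col i B = col j B].
Proof.
case: (@arg_minnP _ j (fun i => col i B == col j B) (@nat_of_ord n)) => //.
move=> i /eqP eqi mini.
exists i; split=> //; first exact: mini.
apply/forallP => i'; apply/implyP => lti; apply: contraTneq lti => eqi'.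
by rewrite -leqNgt mini // eqi' eqi.
Qed.

Lemma new_row_exists n (w : word n) (j : 'I_n) : ~~ pivot w.2 j ->
  exists i : 'I_n, [/\ (i <= j)%N, new_row w i & row i w.1 = row j w.1].
Proof.
move=> npj.
case: (@arg_minnP _ j (fun i => ~~ pivot w.2 i && (row i w.1 == row j w.1))
  (@nat_of_ord n)); first by rewrite npj /=.
move=> i /andP[npi /eqP eqi] mini; exists i; split=> //.
  by apply: mini; rewrite npj /=.
rewrite /new_row npi; apply/forallP => i'; apply/implyP => /andP[lti npi'].
by apply: contraTneq lti => eqi'; rewrite -leqNgt mini // npi' eqi' eqi /=.
Qed.

Definition col_rank n (w : word n) (i : 'I_n) : nat := enum_rank (col i w.2).
Definition row_rank n (w : word n) (i : 'I_n) : nat := enum_rank (row i w.1).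
(** The value 0 blanks out the pivots: between words with the same columns, this block of the key
    compares nonpivot rows only. *)
Definition nonpivot_rank n (w : word n) (i : 'I_n) : nat :=
  if pivot w.2 i then 0%N else row_rank w i.

(* The pivot rows come last because an insertion changes them. *)
Definition word_key n (w : word n) : seqlexi nat :=
  codom (col_rank w) ++ codom (nonpivot_rank w) ++ codom (row_rank w).

Lemma eq_col_rank n (w v : word n) i j : (col_rank w i = col_rank v j) <-> (col i w.2 = col j v.2).
Proof. by split=> [/ord_inj/enum_rank_inj|]; rewrite /col_rank // => ->. Qed.

Lemma eq_row_rank n m (w : word n) (v : word m) i j :
  (row_rank w i = row_rank v j) <-> (row i w.1 = row j v.1).
Proof. by split=> [/ord_inj/enum_rank_inj|]; rewrite /row_rank // => ->. Qed.

Lemma eq_cols n (A B : 'M[R]_(d, n)) : (forall i, col i A = col i B) -> A = B.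
Proof.
by move=> eqc; apply/matrixP => i j; have /colP/(_ i) := eqc j; rewrite !mxE.
Qed.

Lemma word_key_inj n : injective (@word_key n).
Proof.
move=> [A B] [A' B'] /eqP; rewrite !eqseq_cat ?size_codom //.
case/and3P=> /eqP/eq_codomP eqc _ /eqP/eq_codomP eqr; congr (_, _).
  by apply/row_matrixP => i; apply/(@eq_row_rank _ _ (A, B) (A', B')).
by apply: eq_cols => i; apply/(@eq_col_rank _ (A, B) (A', B')).
Qed.

Lemma word_key_ltP n (v w : word n) : (word_key v < word_key w)%O <->
  [\/ first_less (col_rank v) (col_rank w),
      v.2 = w.2 /\ first_less (nonpivot_rank v) (nonpivot_rank w)
    | [/\ v.2 = w.2, nonpivot_rank v =1 nonpivot_rank w
        & first_less (row_rank v) (row_rank w)]].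
Proof.
have eq2 : (codom (col_rank v) = codom (col_rank w)) <-> v.2 = w.2.
  rewrite eq_codomP; split=> [eqc|eq2 i]; last by rewrite /col_rank eq2.
  by apply: eq_cols => i; apply/eq_col_rank.
rewrite /word_key !ltlex_cat ?size_codom //; split.
  case/orP=> [/ltlex_codomP|/andP[/eqP/eq2 e /orP[/ltlex_codomP|/andP[/eqP/eq_codomP e' /ltlex_codomP]]]] lt.
  - by constructor 1.
  - by constructor 2.
  - by constructor 3.
case=> [/ltlex_codomP->//|[/eq2-> /ltlex_codomP->]|[/eq2-> /eq_codomP-> /ltlex_codomP->]].
  by rewrite eqxx orbT.
by rewrite !eqxx !orbT.
Qed.

Section Insertion.
(* The word [w'] arises from [w0] by inserting letters outside the image of [f];
   [s j] is the pivot with the same column as the inserted letter [j], and [c j]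
   an earlier nonpivot with the same row. *)
Variables (n n' : nat) (w0 : word n) (w' : word n').
Variables (f : 'I_n -> 'I_n') (s c : 'I_n' -> 'I_n).
Let inserted j := f (s j) != j.

Hypothesis f_incr : forall i j : 'I_n, (i < j)%N -> (f i < f j)%N.
Hypothesis sK : cancel f s.
Hypothesis f_row : forall i, row (f i) w'.1 = row i w0.1.
Hypothesis f_pivot : forall i, pivot w'.2 (f i) = pivot w0.2 i.
Hypothesis s_col : forall j, col (s j) w0.2 = col j w'.2.
Hypothesis s_le : forall j, (f (s j) <= j)%N.
Hypothesis s_pivot : forall j, inserted j -> pivot w0.2 (s j).
Hypothesis c_row : forall j, inserted j -> row (c j) w0.1 = row j w'.1.
Hypothesis c_le : forall j, inserted j -> (f (c j) <= j)%N.
Hypothesis c_nonpivot : forall j, inserted j -> ~~ pivot w0.2 (c j).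
Hypothesis sum_inserted : forall i, \sum_(j | inserted j && (s j == i)) row j w'.1 = 0.

Definition insert_right : 'M[R]_(n, n') := \matrix_(i, j) (s j == i)%:R.

(** The subtracted sum makes [insert_right *m insert_left] the identity: row [i] of that product
    adds up the rows [j] with [s j = i]. *)
Definition insert_left : 'M[R]_(n', n) := \matrix_j
  (if inserted j then delta_mx 0 (c j) else
   delta_mx 0 (s j) - \sum_(j' | inserted j' && (s j' == s j)) delta_mx 0 (c j')).

Lemma insert_mor : is_VICmor insert_left insert_right.
Proof.
apply/row_matrixP => i; rewrite row_mul row1.
have -> : row i insert_right *m insert_left = \sum_(j | s j == i) row j insert_left.
  rewrite mulmx_sum_row [RHS]big_mkcond; apply: eq_bigr => j _; rewrite !mxE.
  by case: (s j == i); rewrite ?scale1r ?scale0r.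
rewrite (bigD1 (f i)) ?sK //= rowK /inserted sK eqxx /=.
rewrite [X in _ + X](eq_bigr (fun j => delta_mx 0 (c j))); last first.
  move=> j /andP[/eqP sj jf]; rewrite rowK /inserted sj eq_sym jf //.
rewrite [X in _ + X](eq_bigl (fun j => inserted j && (s j == i))) ?subrK // => j.
by rewrite /inserted [RHS]andbC; case: (s j =P i) => //= ->; rewrite eq_sym.
Qed.

Lemma col_insert (B : 'M[R]_(d, n)) j : col j (B *m insert_right) = col (s j) B.
Proof.
apply/colP => i; rewrite !mxE (bigD1 (s j)) //= !mxE eqxx mulr1 big1 ?addr0 // => l.
by rewrite mxE eq_sym => /negPf->; rewrite mulr0.
Qed.

Lemma row_insert (A : 'M[R]_(n, d)) j : row j (insert_left *m A) =
  if inserted j then row (c j) A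
  else row (s j) A - \sum_(j' | inserted j' && (s j' == s j)) row (c j') A.
Proof.
rewrite row_mul rowK; case: ifP => _; first by rewrite rowE.
rewrite mulmxBl -rowE mulmx_suml; congr (_ - _).
by apply: eq_bigr => j' _; rewrite rowE.
Qed.

(** At the old rows the corrections add up to the rows of the letters inserted over one pivot, and
    these sums vanish by [sum_inserted]. *)
Lemma insert_word : word_act insert_left insert_right w0 = w'.
Proof.
case: w' f_row s_col c_row sum_inserted => A' B' /= fr sc cr s0; congr (_, _).
  apply/row_matrixP => j; rewrite row_insert; case: ifPn => [/cr//|jf].
  rewrite (eq_bigr (fun j' => row j' A')) => [|j' /andP[/cr//]].
  by rewrite s0 subr0 -fr; move: jf; rewrite negbK => /eqP->.
by apply: eq_cols => j; rewrite col_insert.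
Qed.

Lemma f_lt i j : (f i < f j)%N -> (i < j)%N.
Proof.
apply: contraTltn; rewrite -leqNgt leq_eqVlt => /predU1P[/ord_inj->//|/f_incr/ltnW//].
Qed.

(** Corrections occur only at pivots, since [s] sends inserted letters to pivots. *)
Lemma row_insert_nonpivot (w : word n) j : ~~ pivot w'.2 j ->
  row j (insert_left *m w.1) = if inserted j then row (c j) w.1 else row (s j) w.1.
Proof.
move=> npj; rewrite row_insert; case: ifPn => // jf; rewrite big1 ?subr0 // => j'.
case/andP=> /s_pivot ps /eqP sj; case/negP: npj; rewrite negbK in jf.
by rewrite -(eqP jf) f_pivot -sj.
Qed.

(** A first difference at [i] moves to [f i]: positions before [f i] are copied from positions
    before [i], because [f (s j)] and [f (c j)] are at most [j]. When the pivot rows decide, the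
    nonpivot rows already agree, so both words receive the same corrections. *)
Lemma insert_key_lt (w : word n) : (word_key w < word_key w0)%O ->
  (word_key (word_act insert_left insert_right w) < word_key w')%O.
Proof.
rewrite -insert_word => /word_key_ltP lt; apply/word_key_ltP.
have cr (v : word n) j :
  col_rank (word_act insert_left insert_right v) j = col_rank v (s j).
  by rewrite /col_rank /= col_insert.
have [[i eqi lti]|[e [i eqi lti]]|[e np [i eqi lti]]] := lt.
- constructor 1; exists (f i); last by rewrite !cr sK.
  by move=> j ji; rewrite !cr; apply: eqi; apply: f_lt; apply: leq_ltn_trans ji.
- constructor 2; split; first by rewrite /= e.
  have npr (v : word n) j : v.2 = w0.2 ->
    nonpivot_rank (word_act insert_left insert_right v) j =
    if pivot w'.2 j then 0%N else if inserted j then nonpivot_rank v (c j) else nonpivot_rank v (s j).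
    move=> ev; rewrite /nonpivot_rank /= ev.
    have -> : w0.2 *m insert_right = w'.2 by rewrite -insert_word.
    case: ifPn => // npj; rewrite /row_rank /= row_insert_nonpivot //.
    case: ifPn => [jf|]; first by rewrite (negPf (c_nonpivot jf)).
    by rewrite negbK -f_pivot => /eqP->; rewrite (negPf npj).
  exists (f i).
    move=> j ji; rewrite !npr //; case: ifP => // _.
    by case: ifPn => [jf|_]; apply: eqi; apply: f_lt; apply: leq_ltn_trans ji; [apply: c_le|apply: s_le].
  move: lti; rewrite !npr // {1 2}/nonpivot_rank e f_pivot.
  case: ifPn => // npi; rewrite /inserted sK eqxx /= /nonpivot_rank e.
  by rewrite (negPf npi).
- have eqnp j : ~~ pivot w0.2 j -> row j w.1 = row j w0.1.
    by move=> npj; have := np j; rewrite /nonpivot_rank e (negPf npj) => /eq_row_rank.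
  have eqc j : inserted j -> row (c j) w.1 = row (c j) w0.1.
    by move=> jf; rewrite eqnp ?c_nonpivot.
  have sumc (v : 'I_n' -> bool) : \sum_(j | inserted j && v j) row (c j) w.1 =
      \sum_(j | inserted j && v j) row (c j) w0.1.
    by apply: eq_bigr => j /andP[/eqc].
  constructor 3; split; first by rewrite /= e.
    move=> j; rewrite /nonpivot_rank /= e.
    have -> : w0.2 *m insert_right = w'.2 by rewrite -insert_word.
    case: ifPn => // npj; apply/eq_row_rank; rewrite /= !row_insert_nonpivot //.
    case: ifPn => [/eqc//|]; rewrite negbK => /eqP jf.
    by apply: eqnp; rewrite -f_pivot jf.
  exists (f i) => [j ji|].
    apply/eq_row_rank; rewrite /= !row_insert; case: ifPn => [/eqc//|_].
    rewrite sumc; congr (_ - _); apply/eq_row_rank.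
    by apply: eqi; apply: f_lt; apply: leq_ltn_trans ji.
  rewrite /row_rank /= !row_insert /inserted sK eqxx /= sumc.
  rewrite (eq_bigr (fun j' => row j' w'.1)) => [|j' /andP[/c_row//]].
  by rewrite sum_inserted !subr0.
Qed.

End Insertion.
End Words.

(** * Encoding labels as words over a finite alphabet *)

Section Codes.
Variables (R : finPzRingType) (d l : nat).
Notation word := (word R d).

Definition letter n (w : word n) (i : 'I_n) :=
  (row i w.1, col i w.2, pivot w.2 i, new_row w i).

(* If two words have equal column sums, then the letters inserted between them
   do not alter the pivot rows. *)
Definition column_sums n (w : word n) : {ffun 'cV[R]_d -> 'rV[R]_d} :=
  [ffun b => \sum_(j | col j w.2 == b) row j w.1].
Definition columns n (w : word n) := [set col j w.2 | j : 'I_n].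
Definition nonpivot_rows n (w : word n) :=
  [set row j w.1 | j : 'I_n & ~~ pivot w.2 j].
Definition profile n (r : 'I_l) (w : word n) :=
  (r, column_sums w, columns w, nonpivot_rows w).

(** The profile is itself a letter, in its own summand, so an embedding of codes must match it with
    the other profile. *)
Definition code n (b : 'I_l * word n) :
    seq ('rV[R]_d * 'cV[R]_d * bool * bool +
         'I_l * {ffun 'cV[R]_d -> 'rV[R]_d} * {set 'cV[R]_d} * {set 'rV[R]_d})%type :=
  inr (profile b.1 b.2) :: [seq inl (letter b.2 i) | i <- enum 'I_n].

Lemma code_embedding n n' (b : 'I_l * word n) (b' : 'I_l * word n') :
  subseq (code b) (code b') ->
  profile b.1 b.2 = profile b'.1 b'.2 /\
  exists2 f : 'I_n -> 'I_n', forall i j : 'I_n, (i < j)%N -> (f i < f j)%N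
    & forall i, letter b'.2 (f i) = letter b.2 i.
Proof.
rewrite /code /=; case: eqP => [[e1 e2 e3 e4]|_] sub; last first.
  have := mem_subseq sub (mem_head _ _).
  by case/mapP.
split; first by rewrite /profile e1 e2 e3 e4.
have [f f_incr f_nth] := subseq_embedding (inr (profile b.1 b.2)) sub.
have flt (i : 'I_n) : (f i < n')%N.
  by have [] := f_nth i; rewrite size_map size_enum_ord // size_map size_enum_ord.
exists (fun i => Ordinal (flt i)) => [i j ij|i].
  by rewrite /=; apply: f_incr; rewrite // inE size_map size_enum_ord.
have [] := f_nth i; first by rewrite size_map size_enum_ord.
rewrite size_map size_enum_ord => fi.
rewrite [RHS](nth_map i) ?size_enum_ord // nth_ord_enum.
rewrite (nth_map (Ordinal (flt i))) ?size_enum_ord //.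
by rewrite (nth_ord_enum _ (Ordinal (flt i))) /letter; case=> -> -> -> ->.
Qed.

Definition basis_key n (b : 'I_l * word n) : seqlexi nat := (b.1 : nat) :: word_key b.2.

Lemma basis_key_inj n : injective (@basis_key n).
Proof. by move=> [r w] [r' w'] [/ord_inj-> /word_key_inj->]. Qed.

Definition basis_act m n (f : 'M[R]_(n, m)) (g : 'M[R]_(m, n)) (b : 'I_l * word m) :
  'I_l * word n := (b.1, word_act f g b.2).

(** Equal column sets force every pivot of [w'] into the image of [f], and equal sets of nonpivot
    rows do the same for new rows. Each inserted letter thus finds an earlier copy of its column and
    of its row, as the insertion requires. *)
Lemma code_act n n' (b0 : 'I_l * word n) (b' : 'I_l * word n') :
  subseq (code b0) (code b') ->
  exists C D, [/\ is_VICmor C D, basis_act C D b0 = b'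
    & forall b, (basis_key b < basis_key b0)%O ->
                (basis_key (basis_act C D b) < basis_key b')%O].
Proof.
case: b0 b' => [r w0] [r' w'] /code_embedding /= [[<- q_eq col_eq row_eq] [f f_incr f_let]].
have f_row i : row (f i) w'.1 = row i w0.1 by have [] := f_let i.
have f_col i : col (f i) w'.2 = col i w0.2 by have [] := f_let i.
have f_pivot i : pivot w'.2 (f i) = pivot w0.2 i by have [] := f_let i.
have f_new i : new_row w' (f i) = new_row w0 i by have [] := f_let i.
have f_inj : injective f.
  move=> i j fij; apply/ord_inj/eqP.
  by case: ltngtP => // /f_incr; rewrite fij ltnn.
have pivot_f j : pivot w'.2 j -> exists i, j = f i.
  move=> pj; have : col j w'.2 \in columns w0 by rewrite col_eq; apply: imset_f.
  case/imsetP=> i0 _ e; have [i [_ pi ei]] := pivot_exists w0.2 i0.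
  by exists i; apply: (@pivot_inj _ _ _ w'.2); rewrite ?f_pivot // f_col ei e.
have new_f j : new_row w' j -> exists i, j = f i.
  move=> nj; have : row j w'.1 \in nonpivot_rows w0.
    by rewrite row_eq; apply: imset_f; rewrite inE; case/andP: nj.
  case/imsetP=> i0; rewrite inE => npi0 e; have [i [_ ni ei]] := new_row_exists npi0.
  by exists i; apply: (@new_row_inj _ _ _ w'); rewrite ?f_new // f_row ei e.
have /choice[s s_spec] : forall j : 'I_n', exists i : 'I_n,
    [/\ (f i <= j)%N, col i w0.2 = col j w'.2 & if j \in codom f then f i = j else pivot w0.2 i].
  move=> j; case: (boolP (j \in codom f)) => [/codomP[i ->]|jf]; first by exists i.
  have [p [pj pp ep]] := pivot_exists w'.2 j.
  by have [i pi] := pivot_f p pp; exists i; rewrite -pi -f_pivot -f_col -pi.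
pose inserted j := f (s j) != j.
have insE j : inserted j = (j \notin codom f).
  have [_ _] := s_spec j; rewrite /inserted; case: ifPn => [_ ->|jf _]; first by rewrite eqxx.
  by apply: contra jf => /eqP<-; apply: codom_f.
have sK : cancel f s.
  by move=> i; apply: f_inj; have [_ _] := s_spec (f i); rewrite codom_f.
have s_pivot j : inserted j -> pivot w0.2 (s j).
  by rewrite insE => /negPf jf; have [_ _] := s_spec j; rewrite jf.
have /choice[c c_spec] : forall j : 'I_n', exists i : 'I_n, inserted j ->
    [/\ (f i <= j)%N, row i w0.1 = row j w'.1 & ~~ pivot w0.2 i].
  move=> j; case: (boolP (inserted j)) => [jf|_]; last by exists (s j).
  have npj : ~~ pivot w'.2 j.
    by apply/negP => /pivot_f[i ji]; move: jf; rewrite insE ji codom_f.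
  have [p [pj np ep]] := new_row_exists npj.
  have [i pi] := new_f p np; exists i => _; rewrite -pi -f_row -f_pivot -pi; split=> //.
  by case/andP: np.
have s_col j : col (s j) w0.2 = col j w'.2 by have [] := s_spec j.
have sum0 i : \sum_(j | inserted j && (s j == i)) row j w'.1 = 0.
  case: (boolP (pivot w0.2 i)) => [pi|npi]; last first.
    by rewrite big_pred0 // => j; apply: contraNF npi => /andP[/s_pivot ps /eqP <-].
  (* The letters in the image of [f] already contribute the column sum of [w0], so the inserted ones
     contribute 0. *)
  have /ffunP/(_ (col i w0.2)) := q_eq; rewrite !ffunE.
  rewrite [RHS](bigID inserted) /= addrC.
  rewrite [X in _ = X + _](_ : _ = \sum_(j | col j w0.2 == col i w0.2) row j w0.1).
    move=> /(etrans (addr0 _)) /addrI e0; rewrite [RHS]e0; apply: eq_bigl => j.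
    rewrite andbC; case: (boolP (inserted j)); rewrite ?andbF // => jf; rewrite !andbT.
    by apply/eqP/eqP => [<-//|e]; apply: (@pivot_inj _ _ _ w0.2); rewrite ?s_pivot ?s_col.
  rewrite (reindex_onto f s) /= => [|j /andP[_]]; last by rewrite negbK => /eqP.
  apply: eq_big => [j|j _]; last exact: f_row.
  by rewrite /inserted sK !eqxx !andbT f_col.
exists (insert_left R f s c), (insert_right R s); split.
- exact: insert_mor.
- by rewrite /basis_act /= (@insert_word _ _ _ _ w0 w') // => j /c_spec[].
move=> [r1 w] /=; rewrite /basis_key /= !ltlex_cons => /orP[->//|/andP[-> lt]].
rewrite orbC (@insert_key_lt _ _ _ _ w0 w') // => j; try by case/c_spec.
by case: (s_spec j).
Qed.

End Codes.

(** * Ascending chains and leading coefficients *)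

Lemma increasing_mono (T : Type) (S : nat -> T -> Prop) :
  (forall n x, S n x -> S n.+1 x) -> forall m n x, (m <= n)%N -> S m x -> S n x.
Proof.
move=> incS m n x; elim: n => [|n IHn]; first by rewrite leqn0 => /eqP->.
by rewrite leq_eqVlt ltnS => /predU1P[->//|mn Sm]; exact: incS (IHn mn Sm).
Qed.

Section Noetherian.
Variable k : pzRingType.

(** The union of the chain is a left ideal, and its finitely many generators all appear at some
    stage. *)
Lemma left_noetherian_acc : left_noetherian k ->
  forall I : nat -> k -> Prop, (forall n, left_ideal (I n)) ->
  (forall n x, I n x -> I n.+1 x) ->
  exists N, forall n, (N <= n)%N -> forall x, I n x -> I N x.
Proof.
move=> noeth I idI incI.
have mono := increasing_mono incI.
have idU : left_ideal (fun x => exists n, I n x).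
  split=> [|x y [m xm] [n yn]|r x [n xn]]; first by exists 0%N; case: (idI 0%N).
    exists (maxn m n); have [_ addI _] := idI (maxn m n).
    by apply: addI; [apply: mono xm; apply: leq_maxl|apply: mono yn; apply: leq_maxr].
  by exists n; have [_ _] := idI n; apply.
have [s s_gen] := noeth _ idU.
have /choice[N hN] : forall i : 'I_(size s), exists n, I n s`_i.
  move=> i; apply/(s_gen s`_i); exists (fun j => (j == i)%:R).
  by rewrite (bigD1 i) //= eqxx mul1r big1 ?addr0 // => j /negPf->; rewrite mul0r.
exists (\max_i N i) => n _ x xn.
have /s_gen[r ->] : exists n, I n x by exists n.
have [I0 addI mulI] := idI (\max_i N i).
have leN i : (N i <= \max_i N i)%N by apply: leq_bigmax.
move: (\max_i N i) I0 addI mulI leN => m I0 addI mulI leN.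
by elim/big_ind: _ => // i _; apply: mulI; apply: mono (hN i).
Qed.

Definition is_submodule (V : lmodType k) (S : V -> Prop) :=
  S 0 /\ forall (a : k) x y, S x -> S y -> S (a *: x + y).

Section Submodule.
Variables (V : lmodType k) (S : V -> Prop).
Hypothesis subS : is_submodule S.

Lemma submodule0 : S 0. Proof. by case: subS. Qed.

Lemma submoduleD x y : S x -> S y -> S (x + y).
Proof. by move=> Sx Sy; rewrite -[x]scale1r; case: subS => _; apply. Qed.

Lemma submoduleZ a x : S x -> S (a *: x).
Proof. by move=> Sx; rewrite -[_ *: _]addr0; case: subS => S0; apply. Qed.

Lemma submoduleN x : S x -> S (- x).
Proof. by rewrite -scaleN1r; apply: submoduleZ. Qed.

Lemma submoduleB x y : S x -> S y -> S (x - y).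
Proof. by move=> Sx /submoduleN; apply: submoduleD. Qed.

Lemma submodule_sum (I : Type) (r : seq I) (P : pred I) (F : I -> V) :
  (forall i, P i -> S (F i)) -> S (\sum_(i <- r | P i) F i).
Proof. by move=> SF; elim/big_ind: _ => //; [apply: submodule0|apply: submoduleD]. Qed.

End Submodule.

Section LeadingCoefficients.
Context {d : Order.disp_t} {W : finType} {K : orderType d} (key : W -> K).
Hypothesis key_inj : injective key.

(** The value at [w] may be 0, so that these coefficients form a left ideal. *)
Definition leading_coef (S : {ffun W -> k^o} -> Prop) (w : W) (c : k) :=
  exists x, [/\ S x, x w = c & forall w', (key w < key w')%O -> x w' = 0].

Lemma leading_coef_ideal S w : is_submodule S -> left_ideal (leading_coef S w).
Proof.
move=> subS; split.
- by exists 0; split=> [||w' _]; rewrite ?ffunE //; apply: (submodule0 subS).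
- move=> _ _ [x [Sx <- x0]] [y [Sy <- y0]]; exists (x + y).
  split=> [||w' lt]; rewrite ?ffunE //; first exact: (submoduleD subS).
  by rewrite x0 // y0 // addr0.
- move=> r _ [x [Sx <- x0]]; exists (r *: x).
  split=> [||w' lt]; rewrite ?ffunE //; first exact: (submoduleZ subS).
  by rewrite x0 // scaler0.
Qed.

(** Subtracting an element of [S] with the same leading term lowers the support; the induction is on
    a bound [m] for the ranks occurring in it. *)
Lemma leading_coef_sub (S S' : {ffun W -> k^o} -> Prop) :
  is_submodule S -> is_submodule S' -> (forall x, S x -> S' x) ->
  (forall w c, leading_coef S' w c -> leading_coef S w c) ->
  forall x, S' x -> S x.
Proof.
move=> subS subS' SS' lead.
suff main m x : S' x -> (forall w, (m <= rank_by key w)%N -> x w = 0) -> S x.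
  move=> x S'x; apply: (main #|W|.+1) => // w; rewrite leqNgt ltnS.
  by rewrite max_card.
elim: m x => [|m IHm] x S'x x0.
  by rewrite (_ : x = 0); [apply: (submodule0 subS)|apply/ffunP => w; rewrite x0 // ffunE].
case: (pickP (fun w => rank_by key w == m)) => [w /eqP wm|nom]; last first.
  by apply: IHm => // w; rewrite leq_eqVlt eq_sym nom; apply: x0.
have [|y [Sy yw y0]] := lead w (x w).
  by exists x; split=> // w' ww'; apply: x0; rewrite -wm rank_byE.
rewrite -[x](subrK y); apply: (submoduleD subS) => //; apply: IHm.
  by apply: (submoduleB subS') => //; apply: SS'.
move=> w'; rewrite leq_eqVlt -wm => /predU1P[/rank_by_inj<-//|ww'].
  by rewrite !ffunE yw subrr.
by rewrite !ffunE x0 -?wm // y0 ?subrr // -rank_byE.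
Qed.

End LeadingCoefficients.
End Noetherian.

(** Formulated for a family [K] inside [M], so that kernels are handled without making them into VIC
    modules. *)
Definition fg_sub (R : finPzRingType) (k : pzRingType) (M : VICmodule R k)
    (K : forall n, obj M n -> Prop) :=
  exists (J : finType) (d : J -> nat) (x : forall j, obj M (d j)),
    (forall j, K (d j) (x j)) /\
    forall N, VICsubmodule N -> (forall j, N (d j) (x j)) ->
      forall n y, K n y -> N n y.

(** * Submodules of free modules are finitely generated *)

Section FreeModule.
Variables (R : finPzRingType) (k : pzRingType) (d l : nat).
Notation basis n := ('I_l * word R d n)%type.

(* All pairs of matrices are allowed as labels, not only the VIC morphisms: no
   subtype is needed, and the noetherianity proof does not see the difference. *)
Definition free_obj n : lmodType k := {ffun basis n -> k^o}.

Definition free_act m n (f : 'M[R]_(n, m)) (g : 'M[R]_(m, n)) (x : free_obj m) : free_obj n :=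
  [ffun b => \sum_(b' | basis_act f g b' == b) x b'].

Lemma free_act_linear m n (f : 'M[R]_(n, m)) g : is_VICmor f g ->
  forall (a : k) (x y : free_obj m),
  free_act f g (a *: x + y) = a *: free_act f g x + free_act f g y.
Proof.
move=> _ a x y; apply/ffunP => b; rewrite !ffunE scaler_sumr -big_split /=.
by apply: eq_bigr => b' _; rewrite !ffunE.
Qed.

Lemma free_act_id n (x : free_obj n) : free_act (1%:M : 'M[R]_n) 1%:M x = x.
Proof.
apply/ffunP => b; rewrite ffunE (big_pred1 b) // => b'.
by case: b' => r [A B]; rewrite /basis_act /word_act /= mul1mx mulmx1.
Qed.

Lemma free_act_comp m n p (f : 'M[R]_(n, m)) g (f2 : 'M[R]_(p, n)) g2 :
  is_VICmor f g -> is_VICmor f2 g2 -> forall x : free_obj m,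
  free_act (f2 *m f) (g *m g2) x = free_act f2 g2 (free_act f g x).
Proof.
move=> _ _ x; apply/ffunP => b; rewrite !ffunE.
have actE b1 : basis_act (f2 *m f) (g *m g2) b1 = basis_act f2 g2 (basis_act f g b1).
  by rewrite /basis_act /word_act /= !mulmxA.
rewrite (partition_big (basis_act f g) (fun b' => basis_act f2 g2 b' == b)); last first.
  by move=> b1; rewrite actE.
apply: eq_bigr => b' /eqP b'b; rewrite ffunE; apply: eq_bigl => b1.
by rewrite actE; case: (basis_act f g b1 =P b') => [->|_]; rewrite ?b'b ?eqxx ?andbF.
Qed.

Definition free_VIC : VICmodule R k :=
  Build_VICmodule free_act_linear free_act_id free_act_comp.

Lemma VICsubmodule_submodule (M : VICmodule R k) (K : forall n, obj M n -> Prop) n :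
  VICsubmodule K -> is_submodule (K n).
Proof. by case=> K0 KD _; split; [apply: K0|apply: KD]. Qed.

Section Submodule.
Hypothesis noeth : left_noetherian k.
Variable K : forall n, obj free_VIC n -> Prop.
Hypothesis subK : VICsubmodule K.

Definition lead (N : forall n, obj free_VIC n -> Prop) (b : {n & basis n}) :=
  leading_coef (@basis_key R d l (tag b)) (N (tag b)) (tagged b).

Definition code_le (b b' : {n & basis n}) := subseq (code (tagged b)) (code (tagged b')).

(** The morphism from [code_act] sends the leading label to [b'] and the rest of the support
    strictly below [b'], so nothing cancels the leading coefficient. *)
Lemma lead_mono N b b' c : VICsubmodule N -> code_le b b' -> lead N b c -> lead N b' c.
Proof.
move=> subN /code_act[C [D [mor e0 mono]]] [x [Nx <- x0]].
have ltb b1 : x b1 != 0 -> b1 != tagged b -> (basis_key b1 < basis_key (tagged b))%O.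
  move=> xb1; case: Order.TotalTheory.ltgtP => // [/x0 e|/basis_key_inj->]; last by rewrite eqxx.
  by rewrite e eqxx in xb1.
exists (free_act C D x); split.
- by case: subN => _ _; apply.
- rewrite ffunE (bigD1 (tagged b)) ?e0 //= big1 ?addr0 // => b1 /andP[/eqP e ne].
  apply/eqP; apply: contraT => /ltb /(_ ne) /mono.
  by rewrite e Order.POrderTheory.ltxx.
- move=> b2 lt2; rewrite ffunE big1 // => b1 /eqP e.
  apply/eqP; apply: contraT => /ltb lt; case: (eqVneq b1 (tagged b)) => [e1|/lt/mono].
    by move: lt2; rewrite -e e1 e0 Order.POrderTheory.ltxx.
  by rewrite e => /(Order.POrderTheory.lt_trans lt2); rewrite Order.POrderTheory.ltxx.
Qed.

(** Otherwise labels can be chosen one after another so that the lead ideal of each is not inside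
    that of any earlier label below it. Higman's lemma extracts an ascending subsequence; its lead
    ideals increase, hence become constant, a contradiction. *)
Lemma lead_finite : exists L : seq {n & basis n}, forall b,
  exists b0, [/\ b0 \in L, code_le b0 b & forall c, lead K b c -> lead K b0 c].
Proof.
apply: contrapT => /forallNP nofin.
have /choice[nx nxP] : forall L : seq {n & basis n}, exists b,
    forall b0, b0 \in L -> code_le b0 b -> ~ forall c, lead K b c -> lead K b0 c.
  move=> L; have /existsNP[b nb] := nofin L; exists b => b0 bL le h.
  by apply: nb; exists b0.
(* [L i] collects the first [i] choices, and [nx (L i)] is the next one. *)
pose L i := iter i (fun s => nx s :: s) [::].
have LP i j : (i < j)%N -> nx (L i) \in L j.
  elim: j => // j IHj; rewrite ltnS leq_eqVlt inE => /predU1P[->|/IHj->]; rewrite ?eqxx ?orbT //.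
have [g g_incr g_sub] := higman (fun i => code (tagged (nx (L i)))).
have [||N hN] := left_noetherian_acc noeth (I := fun i => lead K (nx (L (g i)))).
- move=> i; apply: leading_coef_ideal; exact: (VICsubmodule_submodule _ subK).
- by move=> i c; apply: lead_mono => //; apply: g_sub.
have := nxP (L (g N.+1)) (nx (L (g N))); apply.
- exact/LP/g_incr.
- exact: g_sub.
- by move=> c; apply: hN.
Qed.

Theorem free_noetherian : fg_sub K.
Proof.
have [L LP] := lead_finite.
have idl b : left_ideal (lead K b).
  by apply: leading_coef_ideal; apply: (VICsubmodule_submodule _ subK).
have /choice[s sP] : forall b, exists s : seq k, forall x, lead K b x <->
    exists r : 'I_(size s) -> k, x = \sum_(i < size s) r i * s`_i.
  by move=> b; apply: noeth.
have lead_s b (i : 'I_(size (s b))) : lead K b (s b)`_i.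
  apply/sP; exists (fun j => (j == i)%:R).
  by rewrite (bigD1 i) //= eqxx mul1r big1 ?addr0 // => j /negPf->; rewrite mul0r.
(* One generator for each label in [L] and each generator of its lead ideal. *)
pose J := {i : 'I_(size L) & 'I_(size (s (tnth (in_tuple L) i)))}.
pose bJ (j : J) := tnth (in_tuple L) (tag j).
exists J, (fun j => tag (bJ j)), (fun j => sval (cid (lead_s (bJ j) (tagged j)))).
split=> [j|N subN genN]; first by case: (cid _) => x [].
move=> n y Ky; suff [] : N n y /\ K y by [].
(* [K] is compared with its intersection with [N], since leading coefficients decide equality only
   for nested submodules. *)
apply: (leading_coef_sub (@basis_key_inj R d l n) (S := fun y => N n y /\ K y)
   (S' := @K n)) => //.
- have [N0 ND] := VICsubmodule_submodule n subN; have [K0 KD] := VICsubmodule_submodule n subK.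
  by split=> // a u v [Nu Ku] [Nv Kv]; split; [apply: ND|apply: KD].
- exact: (VICsubmodule_submodule _ subK).
- by move=> x [].
move=> w c lw; have [b0 [b0L le lead0]] := LP (existT _ n w).
have /tnthP[i ei] : b0 \in in_tuple L by [].
have subNK : VICsubmodule (fun n y => N n y /\ K y).
  case: subN subK => N0 ND NA [K0 KD KA]; split=> //.
    by move=> m a u v [Nu Ku] [Nv Kv]; split; [apply: ND|apply: KD].
  by move=> m m' f g u mor [Nu Ku]; split; [apply: NA|apply: KA].
apply: (@lead_mono (fun n y => N n y /\ K y) b0 (existT _ n w)) => //.
have /sP[r ->] := lead0 _ lw.
have [N0 ND NM] : left_ideal (lead (fun n y => N n y /\ K y) b0).
  by apply: leading_coef_ideal; apply: (VICsubmodule_submodule _ subNK).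
elim/big_ind: _ => // j _; apply: NM.
rewrite {}ei in j *.
have := genN (existT _ i j : J); case: (cid _) => x /= [Kx xj x0] Nx.
by exists x.
Qed.

End Submodule.
End FreeModule.
(** * Orbits of the general linear group on words *)

Section GroupStructure.
Variables (R : finPzRingType) (n : nat).

Lemma GL_eqP (g h : GL R n) : (val g).1 = (val h).1 -> (val g).2 = (val h).2 -> g = h.
Proof. by move=> e1 e2; apply: val_inj; apply: injective_projections. Qed.

Lemma GLpredV (g : GL R n) : GLpred ((val g).2, (val g).1).
Proof. by have := valP g; rewrite /GLpred /= andbC. Qed.

Definition GLinv (g : GL R n) : GL R n := exist (fun AB => GLpred AB) _ (GLpredV g).

Lemma GLmulA : associative (@GLmul R n).
Proof. by move=> g h l; apply: GL_eqP; rewrite /= mulmxA. Qed.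

Lemma GLmul1 : left_id (GL1 R n) (@GLmul R n).
Proof. by move=> g; apply: GL_eqP; rewrite /= ?mul1mx ?mulmx1. Qed.

Lemma GL_12 (g : GL R n) : (val g).1 *m (val g).2 = 1%:M.
Proof. by have /andP[/eqP] := valP g. Qed.

Lemma GL_21 (g : GL R n) : (val g).2 *m (val g).1 = 1%:M.
Proof. by have /andP[_ /eqP] := valP g. Qed.

Lemma GLmulV : left_inverse (GL1 R n) GLinv (@GLmul R n).
Proof. by move=> g; apply: GL_eqP; rewrite /= GL_21. Qed.

HB.instance Definition _ := Finite.on (GL R n).
HB.instance Definition _ := Finite_isGroup.Build (GL R n) GLmulA GLmul1 GLmulV.

Lemma GL_mor (g : GL R n) : is_VICmor (val g).1 (val g).2.
Proof. exact: GL_21. Qed.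

End GroupStructure.

Section Orbits.
Variable R : finPzRingType.

Definition genuine d n (w : word R d n) := w.2 *m w.1 == 1%:M.

Definition GLword d n (g : GL R n) (w : word R d n) := word_act (val g).1 (val g).2 w.

Definition iota_l n : 'M[R]_(n.+1, n) := col_mx (0 : 'M_(1, n)) 1%:M.
Definition iota_r n : 'M[R]_(n, n.+1) := row_mx (0 : 'M_(n, 1)) 1%:M.

Lemma iota_mor n : is_VICmor (iota_l n) (iota_r n).
Proof.
rewrite /is_VICmor /iota_l /iota_r -[n.+1]/(1 + n)%N.
by rewrite (@mul_row_col R n 1 n n) mul0mx add0r mul1mx.
Qed.

Lemma GLwordM d n (g h : GL R n) (w : word R d n) : GLword g (GLword h w) = GLword (g * h)%g w.
Proof. by rewrite /GLword /word_act /= !mulmxA. Qed.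

Lemma GLword1 d n (w : word R d n) : GLword 1%g w = w.
Proof. by case: w => A B; rewrite /GLword /word_act /= mul1mx mulmx1. Qed.

Lemma genuine_act d m n (f : 'M[R]_(n, m)) g (w : word R d m) :
  is_VICmor f g -> genuine (word_act f g w) = genuine w.
Proof. by move=> fg; rewrite /genuine /= mulmxA -(mulmxA _ g) fg mulmx1. Qed.

Definition same_orbit d n (w w' : word R d n) := exists g, w = GLword g w'.

Lemma same_orbit_trans d n (w1 w2 w3 : word R d n) :
  same_orbit w1 w2 -> same_orbit w2 w3 -> same_orbit w1 w3.
Proof. by case=> g -> [h ->]; exists (g * h)%g; rewrite GLwordM. Qed.

Lemma same_orbit_genuine d n (w w' : word R d n) : same_orbit w w' -> genuine w = genuine w'.
Proof. by case=> g ->; apply: genuine_act; apply: GL_mor. Qed.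

(** The action of the transvection 1 + x y, which has inverse 1 - x y when y x = 0. *)
Definition shear d n (w : word R d n) (x : 'cV_n) (y : 'rV_n) : word R d n :=
  (w.1 + x *m (y *m w.1), w.2 - w.2 *m x *m y).

Lemma same_orbit_shear d n (w : word R d n) (x : 'cV_n) (y : 'rV_n) : y *m x = 0 ->
  same_orbit w (shear w x y).
Proof.
move=> yx.
have e : x *m y *m (x *m y) = 0 by rewrite mulmxA -(mulmxA x) yx mulmx0 mul0mx.
have gl : GLpred (1%:M - x *m y, 1%:M + x *m y).
  by rewrite /GLpred /= !mulmxDl !mulmxDr ?mulNmx ?mulmxN !mul1mx !mulmx1 e oppr0 !addr0 addrK subrK eqxx.
exists (exist (fun AB => GLpred AB) _ gl); case: w => A B.
have /andP[/eqP e1 _] := gl; congr (_, _); move: e1 => /= e1.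
  have -> : A + x *m (y *m A) = (1%:M + x *m y) *m A by rewrite mulmxDl mul1mx mulmxA.
  by rewrite mulmxA e1 mul1mx.
have -> : B - B *m x *m y = B *m (1%:M - x *m y) by rewrite mulmxBr mulmx1 mulmxA.
by rewrite -mulmxA e1 mulmx1.
Qed.

Lemma row_outer d n (x : 'cV[R]_n) (r : 'rV[R]_d) i : row i (x *m r) = x i 0 *: r.
Proof. by apply/rowP => j; rewrite !mxE big_ord1. Qed.

(** By the pigeonhole principle two rows agree, and their difference gives a zero row [j]. The first
    row is copied into row [j], and the copy is then subtracted from it. *)
Lemma zero_first_row d n (w : word R d n.+1) : (#|{: 'rV[R]_d}| < n.+1)%N ->
  exists2 w', same_orbit w w' & row ord0 w'.1 = 0.
Proof.
move=> ltn; have /injectivePn[i [j ij eqr]] : ~~ injectiveb (fun i => row i w.1).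
  apply: contraL ltn => /injectiveP/leq_card.
  by rewrite card_ord -leqNgt.
have [w1 ww1 w1j] : exists2 w', same_orbit w w' & row j w'.1 = 0.
  exists (shear w (delta_mx j 0) (- delta_mx 0 i)); first apply: same_orbit_shear.
    by rewrite mulNmx mul_delta_mx_0 ?oppr0.
  by rewrite linearD /= mulNmx -rowE row_outer mxE !eqxx scale1r eqr subrr.
case: (eqVneq j ord0) => [<-|j0]; first by exists w1.
have [w2 w12 w2j] : exists2 w', same_orbit w1 w' & row j w'.1 = row ord0 w'.1.
  exists (shear w1 (delta_mx j 0) (delta_mx 0 ord0)); first apply: same_orbit_shear.
    by rewrite mul_delta_mx_0 // eq_sym.
  rewrite !linearD /= -rowE !row_outer w1j !mxE !eqxx scale1r add0r.
  by rewrite eq_sym (negPf j0) scale0r addr0.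
exists (shear w2 (delta_mx ord0 0) (- delta_mx 0 j)); last first.
  by rewrite linearD /= mulNmx -rowE row_outer mxE !eqxx scale1r w2j subrr.
apply: same_orbit_trans ww1 (same_orbit_trans w12 _); apply: same_orbit_shear.
by rewrite mulNmx mul_delta_mx_0 ?oppr0.
Qed.

Lemma orbit_iota d n (w : word R d n.+1) : genuine w -> (#|{: 'rV[R]_d}| < n.+1)%N ->
  exists2 w' : word R d n, same_orbit w (word_act (iota_l n) (iota_r n) w') & genuine w'.
Proof.
move=> gw /(zero_first_row w)[[A B] ww1 /= A0].
have g1 : B *m A = 1%:M by move: gw; rewrite (same_orbit_genuine ww1) => /eqP.
(* Shearing along [x] with the first coordinate covector fixes [A], whose first row is 0; since B A
   = 1, it clears the first column of [B]. *)
pose x := A *m col ord0 B.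
have x0 : delta_mx 0 ord0 *m x = 0 :> 'M_1 by rewrite mulmxA -rowE A0 mul0mx.
have := same_orbit_trans ww1 (same_orbit_shear (A, B) x0).
rewrite /shear /= -rowE A0 mulmx0 addr0 mulmxA g1 mul1mx.
set B' := B - _ => ww'.
have B'0 : col ord0 B' = 0.
  apply/colP => i; rewrite !mxE big_ord1 !mxE eqxx mulr1 subrr //.
move: B' ww' B'0 => B' ww' B'0.
pose w' : word R d n := (@dsubmx _ 1 n d A, @rsubmx _ d 1 n B').
have e : (A, B') = word_act (iota_l n) (iota_r n) w'.
  rewrite /word_act /= /iota_l /iota_r; congr (_, _).
    rewrite (@mul_col_mx R 1 n n d) mul0mx mul1mx -[LHS](@vsubmxK _ 1 n d).
    suff -> : @usubmx _ 1 n d A = 0 by [].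
    apply/rowP => j; have /rowP/(_ j) := A0; rewrite !mxE => <-.
    by congr (A _ _); apply: val_inj.
  rewrite (@mul_mx_row R d n 1 n) mulmx0 mulmx1 -[LHS](@hsubmxK _ d 1 n).
  suff -> : @lsubmx _ d 1 n B' = 0 by [].
  apply/colP => j; have /colP/(_ j) := B'0; rewrite !mxE => <-.
  by congr (B' _ _); apply: val_inj.
rewrite e in ww'; exists w' => //.
by rewrite -(genuine_act _ (iota_mor n)) -(same_orbit_genuine ww').
Qed.

(** Two entries of the row agree, and a shear turns one of them into 0. At that place [j] the column
    entry can be set to 1; this 1 is carried to the first coordinate, where it clears first the
    column and then the row. *)
Lemma orbit_unit_vector n (w : word R 1 n.+1) : genuine w -> (#|R| < n.+1)%N ->
  same_orbit w (delta_mx ord0 0, delta_mx 0 ord0).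
Proof.
move=> gw ltn.
have mul1 (w' : word R 1 n.+1) : same_orbit w w' -> (w'.2 *m w'.1) 0 0 = 1.
  by move/same_orbit_genuine; rewrite gw => /esym/eqP->; rewrite mxE.
have /injectivePn[i [j ij eqr]] : ~~ injectiveb (fun i => w.2 0 i).
  apply: contraL ltn => /injectiveP/leq_card.
  by rewrite card_ord -leqNgt.
have entry (w' : word R 1 n.+1) (x : 'cV_n.+1) (y : 'rV_n.+1) l :
   (shear w' x y).1 l 0 = w'.1 l 0 + x l 0 * (y *m w'.1) 0 0.
  by rewrite !mxE big_ord1 !mxE.
have entry' (w' : word R 1 n.+1) (x : 'cV_n.+1) (y : 'rV_n.+1) l :
   (shear w' x y).2 0 l = w'.2 0 l - (w'.2 *m x) 0 0 * y 0 l.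
  by rewrite !mxE big_ord1 !mxE.
have mulcol (w' : word R 1 n.+1) l : (w'.2 *m delta_mx l (0 : 'I_1)) 0 0 = w'.2 0 l.
  by rewrite -colE mxE.
have mulrow (w' : word R 1 n.+1) l : (delta_mx (0 : 'I_1) l *m w'.1) 0 0 = w'.1 l 0.
  by rewrite -rowE mxE.
have [w1 ww1 w1j] : exists2 w', same_orbit w w' & w'.2 0 j = 0.
  exists (shear w (delta_mx i 0) (delta_mx 0 j)); first apply: same_orbit_shear.
    by rewrite mul_delta_mx_0 // eq_sym.
  by rewrite entry' mulcol mxE !eqxx mulr1 eqr subrr.
have [w2 ww2 w2j] : exists2 w', same_orbit w w' & w'.1 j 0 = 1.
  (* This covector kills [delta_mx j 0] because entry [j] of the row is 0, and takes the missing
     value 1 - w1.1 j 0 on the column because row times column is 1. *)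
  exists (shear w1 (delta_mx j 0) ((1 - w1.1 j 0) *: w1.2)).
    apply: (same_orbit_trans ww1); apply: same_orbit_shear.
    by apply/matrixP => a b; rewrite !ord1 -scalemxAl mxE mulcol w1j mulr0 mxE.
  by rewrite entry mxE !eqxx mul1r -scalemxAl mxE mul1 // mulr1 addrC subrK.
have [w3 ww3 w30] : exists2 w', same_orbit w w' & w'.1 ord0 0 = 1.
  case: (eqVneq j ord0) => [<-|j0]; first by exists w2.
  exists (shear w2 (delta_mx ord0 0) ((1 - w2.1 ord0 0) *: delta_mx 0 j)).
    apply: (same_orbit_trans ww2); apply: same_orbit_shear.
    by rewrite -scalemxAl mul_delta_mx_0 ?scaler0.
  by rewrite entry mxE !eqxx mul1r -scalemxAl mxE mulrow w2j mulr1 addrC subrK.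
have delta1 : delta_mx 0 0 = 1%:M :> 'M[R]_1.
  by apply/matrixP => a b; rewrite !ord1 !mxE.
have e3 : delta_mx 0 ord0 *m w3.1 = 1%:M.
  by apply/matrixP => a b; rewrite !ord1 mulrow w30 mxE.
have [w4 ww4 w40] : exists2 w', same_orbit w w' & w'.1 = delta_mx ord0 0.
  exists (shear w3 (- (w3.1 - delta_mx ord0 0)) (delta_mx 0 ord0)).
    apply: (same_orbit_trans ww3); apply: same_orbit_shear.
    by rewrite mulmxN mulmxBr mul_delta_mx e3 delta1 subrr oppr0.
  by rewrite /= e3 mulmx1 opprB addrC subrK.
have w41 : w4.2 0 ord0 = 1 by have := mul1 _ ww4; rewrite w40 mulcol.
have e4 : w4.2 *m delta_mx ord0 0 = 1%:M :> 'M_1.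
  by apply/matrixP => a b; rewrite !ord1 mulcol w41 mxE.
have y0 : (w4.2 - delta_mx 0 ord0) *m delta_mx ord0 0 = 0 :> 'M_1.
  by rewrite mulmxBl mul_delta_mx e4 delta1 subrr.
apply: (same_orbit_trans ww4); have := same_orbit_shear w4 y0.
by rewrite /shear w40 y0 mulmx0 addr0 e4 mul1mx subKr.
Qed.

Definition extend d n (w : word R d n) : word R d.+1 n.+1 :=
  (block_mx (1%:M : 'M_1) 0 0 w.1, block_mx (1%:M : 'M_1) 0 0 w.2).

Lemma extend_genuine d n (w : word R d n) : genuine (extend w) -> genuine w.
Proof.
rewrite /genuine /extend /= -[d.+1]/(1 + d)%N => /eqP.
rewrite (@mulmx_block R 1 d 1 n 1 d) scalar_mx_block => /eq_block_mx[_ _ _].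
by rewrite mulmx0 add0r => ->.
Qed.

(** The first row of [A] and the first column of [B], beyond their corner entries, are the
    off-diagonal blocks of B A = 1. *)
Lemma genuine_extend d n (w : word R d.+1 n.+1) : genuine w ->
  col ord0 w.1 = delta_mx ord0 0 -> row ord0 w.2 = delta_mx 0 ord0 ->
  exists w' : word R d n, w = extend w'.
Proof.
case: w => A B /= gw Ac Br; exists (@drsubmx _ 1 n 1 d A, @drsubmx _ 1 d 1 n B).
have Aul : @ulsubmx _ 1 n 1 d A = 1%:M.
  apply/matrixP => i j; have /colP/(_ ord0) := Ac; rewrite !ord1 !mxE !eqxx => <-.
  by congr (A _ _); apply: val_inj.
have Adl : @dlsubmx _ 1 n 1 d A = 0.
  apply/matrixP => i j; have /colP/(_ (@rshift 1 n i)) := Ac; rewrite !ord1 !mxE -!val_eqE /= => e.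
  by apply: etrans e; congr (A _ _); apply: val_inj.
have Bul : @ulsubmx _ 1 d 1 n B = 1%:M.
  apply/matrixP => i j; have /rowP/(_ ord0) := Br; rewrite !ord1 !mxE !eqxx => <-.
  by congr (B _ _); apply: val_inj.
have Bur : @ursubmx _ 1 d 1 n B = 0.
  apply/matrixP => i j; have /rowP/(_ (@rshift 1 n j)) := Br; rewrite !ord1 !mxE -!val_eqE /= => e.
  by apply: etrans e; congr (B _ _); apply: val_inj.
have /eqP := gw; rewrite /= -{1}[A](@submxK _ 1 n 1 d) -{1}[B](@submxK _ 1 d 1 n).
rewrite Aul Adl Bul Bur (@mulmx_block R 1 d 1 n 1 d) -[d.+1]/(1 + d)%N scalar_mx_block.
rewrite !(mul1mx, mulmx1, mul0mx, mulmx0, addr0) => /eq_block_mx[_ Aur Bdl _].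
by rewrite /extend /= -Aur -[LHS]/(A, B) -[in LHS](@submxK _ 1 n 1 d A)
  -[in LHS](@submxK _ 1 d 1 n B) Aul Adl Bul Bur Aur Bdl.
Qed.

(** The first column and the first row form a morphism from R^1, which is moved onto the first
    coordinate. *)
Lemma orbit_extend d n (w : word R d.+1 n.+1) : genuine w -> (#|R| < n.+1)%N ->
  exists2 w' : word R d n, same_orbit w (extend w') & genuine w'.
Proof.
move=> gw ltn; pose v : word R 1 n.+1 := (col ord0 w.1, row ord0 w.2).
have gv : genuine v.
  apply/eqP/matrixP => a b; rewrite !ord1 mxE; transitivity ((w.2 *m w.1) ord0 ord0).
    by rewrite mxE; apply: eq_bigr => l _; rewrite !mxE.
  by rewrite (eqP gw) !mxE.
have [g [ve1 ve2]] := orbit_unit_vector gv ltn.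
have gw1 : genuine (GLword g^-1%g w) by rewrite genuine_act ?gw //; apply: GL_mor.
have [||w' e] := genuine_extend gw1.
- by rewrite /= colE -mulmxA -colE ve1 mulmxA GL_21 mul1mx.
- by rewrite /= rowE mulmxA -rowE ve2 -mulmxA GL_21 mulmx1.
exists w'; last by apply: extend_genuine; rewrite -e.
by exists g; rewrite -e GLwordM mulgV GLword1.
Qed.

End Orbits.
(** * The bar complex in homogeneous coordinates *)

Definition delete (T : Type) (i : nat) (X : seq T) := take i X ++ drop i.+1 X.

Lemma size_delete (T : Type) i (X : seq T) : (i < size X)%N -> (size (delete i X)).+1 = size X.
Proof.
move=> iX; rewrite size_cat size_take size_drop iX.
by rewrite subnS -addnS prednK ?subn_gt0 // subnKC // ltnW.
Qed.

(** [Psi] evaluated on the boundary of the simplex [X]. Working with functions of tuples avoids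
    formal sums; the complex is augmented, with value [Psi [::]] on a one-term list. *)
Definition coboundary (k : pzRingType) (V : lmodType k) (G : Type) (Psi : seq G -> V) X : V := \sum_(i < size X) (-1) ^+ i *: Psi (delete i X).

Lemma coboundary_map (k : pzRingType) (V : lmodType k) (G G' : Type) (h : G -> G')
    (Psi : seq G' -> V) (X : seq G) :
  coboundary Psi (map h X) = coboundary (Psi \o map h) X.
Proof.
by rewrite /coboundary size_map; apply: eq_bigr => i _; rewrite /delete /= map_cat map_take map_drop.
Qed.

Section Cochains.
Variables (k : pzRingType) (G : Type) (V : lmodType k).
Implicit Types (Psi : seq G -> V) (X : seq G).

Lemma coboundary_cons Psi x X :
  coboundary Psi (x :: X) = Psi X - coboundary (fun Y => Psi (x :: Y)) X.
Proof.
rewrite /coboundary big_ord_recl expr0 scale1r /delete /= drop0 -sumrN.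
by congr (_ + _); apply: eq_bigr => i _; rewrite exprS mulN1r scaleNr.
Qed.

Lemma coboundaryB Psi Psi' X :
  coboundary (fun Y => Psi Y - Psi' Y) X = coboundary Psi X - coboundary Psi' X.
Proof. by rewrite /coboundary -sumrB; apply: eq_bigr => i _; rewrite scalerBr. Qed.

Lemma eq_coboundary Psi Psi' X : (forall Y, (size Y).+1 = size X -> Psi Y = Psi' Y) ->
  coboundary Psi X = coboundary Psi' X.
Proof.
by move=> e; apply: eq_bigr => i _; rewrite e // size_delete.
Qed.

Lemma coboundaryK Psi X : coboundary (coboundary Psi) X = 0.
Proof.
elim: X Psi => [|x X IHX] Psi; first by rewrite /coboundary big_ord0.
rewrite coboundary_cons [Z in _ - Z](_ : _ =
    coboundary (fun Y => Psi Y - coboundary (fun Z => Psi (x :: Z)) Y) X); last first.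
  by apply: eq_coboundary => Y _; rewrite coboundary_cons.
by rewrite coboundaryB IHX subr0 subrr.
Qed.

Section Prism.
Variable h : G -> G.

(** The alternating sum of [Psi] over x_0, ..., x_i, h x_i, ..., h x_p: the triangulated prism
    between the identity and [h]. *)
Fixpoint prism Psi X : V :=
  if X is x :: Y then Psi (x :: h x :: map h Y) - prism (fun Z => Psi (x :: Z)) Y else 0.

Lemma prismB Psi Psi' X : prism (fun Y => Psi Y - Psi' Y) X = prism Psi X - prism Psi' X.
Proof.
elim: X Psi Psi' => [|x X IHX] Psi Psi' /=; first by rewrite subrr.
by rewrite IHX !opprB addrACA [RHS]addrACA; congr (_ + _); rewrite addrC.
Qed.

Lemma eq_prism Psi Psi' X : (forall Y, size Y = (size X).+1 -> Psi Y = Psi' Y) ->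
  prism Psi X = prism Psi' X.
Proof.
elim: X Psi Psi' => //= x X IHX Psi Psi' e; rewrite e /= ?size_map //.
by congr (_ - _); apply: IHX => Y sY; rewrite e //= sY.
Qed.

Lemma prism_homotopy Psi X :
  prism (coboundary Psi) X + coboundary (prism Psi) X = Psi (map h X) - Psi X.
Proof.
elim: X Psi => [|x X IHX] Psi; first by rewrite /coboundary big_ord0 addr0 subrr.
have e1 : prism (fun Z => coboundary Psi (x :: Z)) X =
    prism Psi X - prism (coboundary (fun Y => Psi (x :: Y))) X.
  by rewrite -prismB; apply: eq_prism => Y _; rewrite coboundary_cons.
have e2 : coboundary (fun Y => prism Psi (x :: Y)) X =
    coboundary (fun Y => Psi (x :: h x :: Y)) (map h X)
    - coboundary (prism (fun Y => Psi (x :: Y))) X.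
  by rewrite coboundary_map -coboundaryB; apply: eq_coboundary.
rewrite coboundary_cons e2 [prism (coboundary Psi) _]/= e1 !coboundary_cons.
have := IHX (fun Y => Psi (x :: Y)).
rewrite addrC => /(canRL (addrK _)) eb; rewrite [Psi (map h (x :: X))]/=.
rewrite {}eb; set c := coboundary _ (map h X).
set u := Psi (_ :: map h X); set v := Psi (x :: map h X); set w := prism Psi X.
rewrite !opprB -!addrA; congr (u + _).
by rewrite addKr [c + _]addrC -!addrA addNr addr0 (addrCA _ v) addKr addrC subrK.
Qed.

End Prism.
End Cochains.
Section LinearFunctions.
Variables (k : pzRingType) (V W : lmodType k) (f : V -> W).
Hypothesis lin : linear f.

Lemma linD x y : f (x + y) = f x + f y.
Proof. by have := lin 1 x y; rewrite !scale1r. Qed.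

Lemma lin0 : f 0 = 0.
Proof. by have := linD 0 0; rewrite addr0 => /(etrans (addr0 _))/addrI. Qed.

Lemma linZ a x : f (a *: x) = a *: f x.
Proof. by have := lin a x 0; rewrite !addr0 lin0 addr0. Qed.

Lemma linB x y : f (x - y) = f x - f y.
Proof. by rewrite -scaleN1r linD linZ scaleN1r. Qed.

Lemma lin_sum (I : Type) (r : seq I) (P : pred I) (F : I -> V) :
  f (\sum_(i <- r | P i) F i) = \sum_(i <- r | P i) f (F i).
Proof. by elim/big_rec2: _ => [|i y z _ <-]; rewrite ?lin0 ?linD. Qed.

Lemma lin_if (b : bool) x : f (if b then x else 0) = if b then f x else 0.
Proof. by case: b; rewrite ?lin0. Qed.

End LinearFunctions.

(** * Simplices in the inhomogeneous bar complex *)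

Section BarChains.
Variables (R : finPzRingType) (k : pzRingType) (M : VICmodule R k).

Lemma act_lin m n (f : 'M[R]_(n, m)) g : is_VICmor f g -> linear (@act R k M m n f g).
Proof. by move=> fg a x y; apply: act_linear. Qed.

Lemma GLact_lin n (g : GL R n) : linear (@GLact R k M n g).
Proof. exact: (act_lin (GL_mor g)). Qed.

Definition bar n p (t : {ffun 'I_p -> GL R n}) (x : obj M n) : chain M n p :=
  fun s => if s == t then x else 0.

Definition differences n p (X : seq (GL R n)) : {ffun 'I_p -> GL R n} :=
  [ffun j : 'I_p => ((nth 1 X j)^-1 * nth 1 X j.+1)%g].

(** The homogeneous simplex with first vertex 1 that represents the bar symbol [t]. *)
Definition vertices n p (t : {ffun 'I_p -> GL R n}) : seq (GL R n) :=
  mkseq (fun j => \prod_(i < j) gt t i)%g p.+1.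

(* The image of the homogeneous simplex [X] with coefficient [x] in the
   inhomogeneous bar complex. *)
Definition simplex n p (X : seq (GL R n)) (x : obj M n) : chain M n p :=
  bar (differences p X) (GLact_inv (nth 1%g X 0) x).
Arguments simplex [n] p X x.

Lemma gtE n p (t : {ffun 'I_p -> GL R n}) j (jp : (j < p)%N) : gt t j = t (Ordinal jp).
Proof. by rewrite /gt insubT. Qed.

Lemma size_vertices n p (t : {ffun 'I_p -> GL R n}) : size (vertices t) = p.+1.
Proof. by rewrite size_mkseq. Qed.

Lemma differences_vertices n p (t : {ffun 'I_p -> GL R n}) : differences p (vertices t) = t.
Proof.
apply/ffunP => j; rewrite ffunE !nth_mkseq ?ltnS ?(ltnW (ltn_ord j)) //.
by rewrite big_ord_recr /= mulKg gtE; congr (t _); apply: val_inj.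
Qed.

Lemma vertices_differences n p (X : seq (GL R n)) : size X = p.+1 ->
  vertices (differences p X) = map (fun x => ((nth 1 X 0)^-1 * x)%g) X.
Proof.
move=> sX; apply: (@eq_from_nth _ 1%g); first by rewrite size_vertices size_map sX.
move=> i; rewrite size_vertices => ip; rewrite nth_mkseq // (nth_map 1%g) ?sX //.
elim: i ip => [|i IHi] ip; first by rewrite big_ord0 mulVg.
rewrite big_ord_recr /= IHi; last exact: ltnW.
by rewrite gtE ffunE /= -mulgA mulKVg.
Qed.

Lemma nth_delete (T : Type) (x0 : T) i j (X : seq T) : (i <= size X)%N ->
  nth x0 (delete i X) j = nth x0 X (if (j < i)%N then j else j.+1).
Proof.
move=> iX; rewrite /delete nth_cat size_take_min (minn_idPl iX); case: ltnP => ji.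
  by rewrite nth_take.
by rewrite nth_drop addSn subnKC.
Qed.

Lemma face_differences n p i (X : seq (GL R n)) : (i < p.+2)%N -> size X = p.+2 ->
  face i (differences p.+1 X) = differences p (delete i X).
Proof.
move=> ip sX; apply/ffunP => j; rewrite !ffunE.
have jp : (j < p)%N := ltn_ord j.
have iX : (i <= size X)%N by rewrite sX ltnW.
rewrite !nth_delete //.
rewrite (gtE _ (leqW jp)) (gtE _ (jp : (j.+1 < p.+1)%N)) !ffunE /=.
case: (ltngtP j.+1 i) => // ji.
transitivity ((nth 1 X j)^-1 * nth 1 X j.+1 * ((nth 1 X j.+1)^-1 * nth 1 X j.+2))%g => //.
by rewrite -mulgA mulKVg.
Qed.

Lemma GLact_invE n (g : GL R n) (x : obj M n) : GLact_inv g x = GLact (g^-1)%g x.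
Proof. by []. Qed.

Lemma GLactM n (g h : GL R n) (x : obj M n) : GLact (g * h)%g x = GLact g (GLact h x).
Proof. by rewrite /GLact /= act_comp //; apply: GL_mor. Qed.

Lemma GLact1 n (x : obj M n) : GLact (1%g : GL R n) x = x.
Proof. exact: act_id. Qed.

Lemma GLact_inv_if n (g : GL R n) b (x : obj M n) :
  GLact_inv g (if b then x else 0) = if b then GLact_inv g x else 0.
Proof. exact: (lin_if (GLact_lin g^-1%g)). Qed.

(** Deleting the first vertex moves the base point from x_0 to x_1, which accounts for the twist by
    g_1^-1 in the first face. *)
Lemma bnd_simplex n p (X : seq (GL R n)) (x : obj M n) s : size X = p.+2 ->
  bnd (simplex p.+1 X x) s = coboundary (fun Y => simplex p Y x s) X.
Proof.
move=> sX; rewrite /bnd /coboundary sX; apply: eq_bigr => i _.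
rewrite big_mkcond (bigD1 (differences p.+1 X)) //= big1 ?addr0; last first.
  move=> t /negPf tX; rewrite /simplex /bar tX.
  by rewrite (GLact_inv_if _ false 0) if_same scaler0 if_same.
rewrite /simplex {2 3}/bar eqxx face_differences //.
rewrite /bar eq_sym; case: eqP => _; last by rewrite scaler0.
have iX : (i <= size X)%N by rewrite sX ltnW.
congr (_ *: _); rewrite nth_delete // lt0n; case: eqP => [i0|_] //=.
rewrite gtE ffunE !GLact_invE eqxx -GLactM /=; congr (GLact _ x).
by rewrite invMg invgK mulgK.
Qed.

Lemma bnd_sum n p (I : finType) (F : I -> chain M n p.+1) (a : I -> k) s :
  bnd (fun t => \sum_i a i *: F i t) s = \sum_i a i *: bnd (F i) s.
Proof.
rewrite /bnd; under [RHS]eq_bigr do rewrite scaler_sumr; rewrite exchange_big /=.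
apply: eq_bigr => i _; under [RHS]eq_bigr do rewrite scaler_sumr.
rewrite exchange_big; apply: eq_bigr => t _.
case: ifP => _.
  rewrite GLact_invE (lin_sum (GLact_lin _)) scaler_sumr; apply: eq_bigr => j _.
  by rewrite (linZ (GLact_lin _)) !scalerA commr_sign.
by rewrite scaler_sumr; apply: eq_bigr => j _; rewrite !scalerA commr_sign.
Qed.

Lemma eq_bnd n p (c c' : chain M n p.+1) s : c =1 c' -> bnd c s = bnd c' s.
Proof. by move=> /funext->. Qed.

Lemma chainE n p (c : chain M n p) s : c s = \sum_t simplex p (vertices t) (c t) s.
Proof.
rewrite (bigD1 s) //= /simplex differences_vertices /bar eqxx big1 ?addr0.
  by rewrite nth_mkseq // big_ord0 GLact_invE invg1 GLact1.
by move=> t; rewrite eq_sym differences_vertices => /negPf->.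
Qed.

Lemma bndE n p (c : chain M n p.+1) s :
  bnd c s = \sum_t coboundary (fun Y => simplex p Y (c t) s) (vertices t).
Proof.
rewrite (@eq_bnd _ _ _ (fun s' => \sum_t 1 *: simplex p.+1 (vertices t) (c t) s')).
  rewrite bnd_sum; apply: eq_bigr => t _.
  by rewrite scale1r bnd_simplex // size_vertices.
by move=> s'; rewrite [LHS]chainE; apply: eq_bigr => t _; rewrite scale1r.
Qed.

Lemma bnd_bnd n p (c : chain M n p.+2) s : bnd (bnd c) s = 0.
Proof.
rewrite (@eq_bnd _ _ _ (fun s' => \sum_t 1 *: \sum_(i < size (vertices t))
   (-1) ^+ i *: simplex p.+1 (delete i (vertices t)) (c t) s')); last first.
  by move=> s'; rewrite bndE; apply: eq_bigr => t _; rewrite scale1r.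
rewrite bnd_sum big1 // => t _; rewrite scale1r bnd_sum.
rewrite -[RHS](coboundaryK (fun Y => simplex p Y (c t) s) (vertices t)).
apply: eq_bigr => i _; rewrite bnd_simplex //; apply/eqP.
by rewrite -eqSS size_delete // size_vertices.
Qed.

Lemma is_cycle_bnd n p (c : chain M n p.+1) : is_cycle (bnd c).
Proof. by case: p c => // p c s; apply: bnd_bnd. Qed.

End BarChains.
Arguments simplex {R k M n} p X x.

(** * The stabilization map on chains *)

Section Stabilization.
Variables (R : finPzRingType) (k : pzRingType) (M : VICmodule R k).

Lemma GLpred_extend n (g : GL R n) : GLpred (extend (val g)).
Proof.
apply/andP; split; apply/eqP; rewrite /= (@mulmx_block R 1 n 1 n 1 n) !mul1mx !mulmx0 !mul0mx
  ?(GL_12, GL_21) !(addr0, add0r) -scalar_mx_block //.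
Qed.

Definition GLext n (g : GL R n) : GL R n.+1 := exist (fun AB => GLpred AB) _ (GLpred_extend g).

Lemma extend_inj d n : injective (@extend R d n).
Proof.
move=> [A B] [A' B'] [eA eB]; congr (_, _).
  by have [] := @eq_block_mx _ 1 n 1 d _ _ _ _ _ _ _ _ eA.
by have [] := @eq_block_mx _ 1 d 1 n _ _ _ _ _ _ _ _ eB.
Qed.

Lemma GLext_inj n : injective (@GLext n).
Proof. by move=> g h /(congr1 val) /extend_inj /val_inj. Qed.

Lemma GLextM n : {morph @GLext n : g h / (g * h)%g}.
Proof.
move=> g h; apply: GL_eqP; rewrite /= (@mulmx_block R 1 n 1 n 1 n);
by rewrite !(mul1mx, mulmx0, mul0mx, addr0, add0r).
Qed.

Lemma GLext1 n : GLext 1%g = 1%g :> GL R n.+1.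
Proof. by apply: (@mulgI _ (GLext 1%g)); rewrite -GLextM !mulg1. Qed.

Lemma GLextV n (g : GL R n) : GLext g^-1%g = (GLext g)^-1%g.
Proof. by apply: (@mulgI _ (GLext g)); rewrite -GLextM !mulgV GLext1. Qed.

Definition vic_iota n : obj M n -> obj M n.+1 := act (iota_l R n) (iota_r R n).

Lemma iota_lin n : linear (@vic_iota n).
Proof. exact: (act_lin (iota_mor R n)). Qed.

Lemma iota_GLact n (g : GL R n) (x : obj M n) :
  vic_iota (GLact g x) = GLact (GLext g) (vic_iota x).
Proof.
rewrite /vic_iota /GLact -!act_comp; try exact: GL_mor; try exact: iota_mor.
congr (act _ _ x).
  rewrite /= /iota_l (@mul_col_mx R 1 n n n) (@mul_block_col R 1 n 1 n n).
  by rewrite !(mul0mx, mul1mx, mulmx1, mulmx0, addr0, add0r).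
rewrite /= /iota_r (@mul_mx_row R n n 1 n) (@mul_row_block R n 1 n 1 n).
by rewrite !(mul0mx, mul1mx, mulmx1, mulmx0, addr0, add0r).
Qed.

Definition GLexts n p (t : {ffun 'I_p -> GL R n}) : {ffun 'I_p -> GL R n.+1} :=
  [ffun j => GLext (t j)].

Definition stab n p (c : chain M n p) : chain M n.+1 p :=
  fun s => \sum_t bar (GLexts t) (vic_iota (c t)) s.

Lemma bar_lin n p (t s : {ffun 'I_p -> GL R n}) : linear (fun x : obj M n => bar t x s).
Proof. by move=> a x y; rewrite /bar; case: ifP => // _; rewrite scaler0 addr0. Qed.

Lemma simplex_lin n p X (s : {ffun 'I_p -> GL R n}) : linear (fun x : obj M n => simplex p X x s).
Proof. by move=> a x y; rewrite /simplex GLact_invE (GLact_lin _ a) bar_lin. Qed.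

Lemma stab_sum n p (I : finType) (a : I -> k) (F : I -> chain M n p) s :
  stab (fun t => \sum_i a i *: F i t) s = \sum_i a i *: stab (F i) s.
Proof.
rewrite /stab; under [RHS]eq_bigr do rewrite scaler_sumr; rewrite exchange_big.
apply: eq_bigr => t _; rewrite (lin_sum (@iota_lin n)) (lin_sum (bar_lin _ _)).
by apply: eq_bigr => i _; rewrite (linZ (@iota_lin n)) (linZ (bar_lin _ _)).
Qed.

Lemma stab_lin n p a (c c' : chain M n p) s :
  stab (fun t => a *: c t + c' t) s = a *: stab c s + stab c' s.
Proof.
rewrite /stab scaler_sumr -big_split; apply: eq_bigr => t _ /=.
by rewrite (@iota_lin n) bar_lin.
Qed.

Lemma eq_stab n p (c c' : chain M n p) s : c =1 c' -> stab c s = stab c' s.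
Proof. by move=> /funext->. Qed.

Lemma stab_bar n p (t : {ffun 'I_p -> GL R n}) x s :
  stab (bar t x) s = bar (GLexts t) (vic_iota x) s.
Proof.
rewrite /stab (bigD1 t) //= big1 ?addr0 /bar ?eqxx // => t' /negPf->.
by rewrite (lin0 (@iota_lin n)) if_same.
Qed.

Lemma nth_GLext n (X : seq (GL R n)) i : nth 1%g (map (@GLext n) X) i = GLext (nth 1%g X i).
Proof.
case: (ltnP i (size X)) => iX; first by rewrite (nth_map 1%g).
by rewrite !nth_default ?size_map // GLext1.
Qed.

Lemma stab_simplex n p X (x : obj M n) s :
  stab (simplex p X x) s = simplex p (map (@GLext n) X) (vic_iota x) s.
Proof.
rewrite stab_bar /simplex nth_GLext !GLact_invE -GLextV -iota_GLact.
congr (bar _ _ _); apply/ffunP => j.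
by rewrite !ffunE !nth_GLext -GLextV -GLextM.
Qed.

(** [GLext] is injective, so a single term contributes. A chain can thus be recovered from its
    stabilization when [vic_iota] is injective. *)
Lemma stab_image n p (c : chain M n p) (t : {ffun 'I_p -> GL R n}) :
  stab c (GLexts t) = vic_iota (c t).
Proof.
rewrite /stab (bigD1 t) //= {1}/bar eqxx big1 ?addr0 // => t' tt'.
rewrite /bar; case: eqP => // /ffunP e; case/eqP: tt'; apply/ffunP => j.
by have := e j; rewrite !ffunE => /GLext_inj.
Qed.

Lemma bnd_stab n p (c : chain M n p.+1) s : bnd (stab c) s = stab (bnd c) s.
Proof.
rewrite (@eq_bnd _ _ _ _ _ _ (fun s' => \sum_t 1 *: simplex p.+1 (map (@GLext n) (vertices t)) (vic_iota (c t)) s')).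
  rewrite (@eq_stab _ _ _ (fun s' => \sum_t 1 *: \sum_(i < size (vertices t))
    (-1) ^+ i *: simplex p (delete i (vertices t)) (c t) s')).
    rewrite bnd_sum stab_sum; apply: eq_bigr => t _; congr (_ *: _).
    rewrite bnd_simplex; last by rewrite size_map size_vertices.
    rewrite coboundary_map.
    rewrite [RHS](stab_sum _ (fun i : 'I__ => simplex p (delete i (vertices t)) (c t))).
    by apply: eq_bigr => i _; congr (_ *: _); rewrite stab_simplex.
  by move=> s'; rewrite bndE; apply: eq_bigr => t _; rewrite scale1r.
move=> s'; rewrite (@eq_stab _ _ _ (fun s' => \sum_t 1 *: simplex p.+1 (vertices t) (c t) s')).
  by rewrite stab_sum; apply: eq_bigr => t _; rewrite stab_simplex.
by move=> s''; rewrite [LHS]chainE; apply: eq_bigr => t _; rewrite scale1r.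
Qed.

Lemma is_cycle_stab n p (c : chain M n p) : is_cycle c -> is_cycle (stab c).
Proof.
case: p c => // p c cyc s; rewrite bnd_stab (@eq_stab _ _ _ (fun=> 0)) //.
by rewrite /stab big1 // => t _; rewrite (lin0 (@iota_lin n)) (lin0 (bar_lin _ _)).
Qed.

Lemma bnd_lin n p a (c c' : chain M n p.+1) s :
  bnd (fun t => a *: c t + c' t) s = a *: bnd c s + bnd c' s.
Proof.
have := bnd_sum (fun b : bool => if b then c else c') (fun b => if b then a else 1) s.
by rewrite big_bool /= scale1r => <-; apply: eq_bnd => t; rewrite big_bool /= scale1r.
Qed.

Lemma bndZ n p a (c : chain M n p.+1) s : bnd (fun t => a *: c t) s = a *: bnd c s.
Proof.
have := bnd_sum (fun=> c) (fun _ : 'I_1 => a) s; rewrite big_ord1 => <-.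
by apply: eq_bnd => t; rewrite big_ord1.
Qed.

Lemma bndN n p (c : chain M n p.+1) s : bnd (fun t => - c t) s = - bnd c s.
Proof. by rewrite -scaleN1r -bndZ; apply: eq_bnd => t; rewrite scaleN1r. Qed.

Lemma bndD n p (c c' : chain M n p.+1) s : bnd (fun t => c t + c' t) s = bnd c s + bnd c' s.
Proof. by rewrite -[bnd c s]scale1r -bnd_lin; apply: eq_bnd => t; rewrite scale1r. Qed.

Lemma bndB n p (c c' : chain M n p.+1) s : bnd (fun t => c t - c' t) s = bnd c s - bnd c' s.
Proof. by rewrite -bndN -bndD. Qed.

Lemma is_cycle_lin n p a (c c' : chain M n p) :
  is_cycle c -> is_cycle c' -> is_cycle (fun t => a *: c t + c' t).
Proof.
by case: p c c' => // p c c' cc cc' s; rewrite bnd_lin cc cc' scaler0 addr0.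
Qed.

Section Valued.
Variable K : forall n, obj M n -> Prop.
Hypothesis subK : VICsubmodule K.

(** Chains with coefficients in the submodule [K] are kept as chains of [M]. *)
Definition valued n p (c : chain M n p) := forall t, K (c t).

Lemma valued_lin n p a (c c' : chain M n p) :
  valued c -> valued c' -> valued (fun t => a *: c t + c' t).
Proof. by move=> Kc Kc' t; case: subK => _ KD _; apply: KD. Qed.

Lemma valued_stab n p (c : chain M n p) : valued c -> valued (stab c).
Proof.
move=> Kc s; apply: (submodule_sum (VICsubmodule_submodule _ subK)) => t _.
rewrite /bar; case: ifP => _; last exact: (submodule0 (VICsubmodule_submodule _ subK)).
by case: subK => _ _; apply; [apply: iota_mor|apply: Kc].
Qed.

End Valued.
End Stabilization.

(** * Maps of VIC modules *)

Section ModuleMaps.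
Variables (R : finPzRingType) (k : pzRingType) (M M' : VICmodule R k).
Variable psi : forall n, obj M n -> obj M' n.

Definition VIC_map := (forall n, linear (@psi n)) /\
  forall m n (f : 'M[R]_(n, m)) g x, is_VICmor f g -> psi (act f g x) = act f g (psi x).

Hypothesis psi_map : VIC_map.

Lemma bnd_map n p (c : chain M n p.+1) s : bnd (fun t => psi (c t)) s = psi (bnd c s).
Proof.
have [lin equiv] := psi_map; rewrite (lin_sum (lin n)); apply: eq_bigr => i _.
rewrite (lin_sum (lin n)); apply: eq_bigr => t _; rewrite (linZ (lin n)).
by case: ifP => // _; rewrite [in RHS]/GLact_inv equiv //; apply: (GL_mor (gt t 0)^-1%g).
Qed.

Lemma is_cycle_map n p (c : chain M n p) : is_cycle c -> is_cycle (fun t => psi (c t)).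
Proof.
by case: p c => // p c cyc s; rewrite bnd_map cyc; apply: (lin0 (proj1 psi_map n)).
Qed.

Lemma stab_map n p (c : chain M n p) s : stab (fun t => psi (c t)) s = psi (stab c s).
Proof.
have [lin equiv] := psi_map; rewrite (lin_sum (lin n.+1)); apply: eq_bigr => t _.
rewrite /bar; case: ifP => _; last by rewrite (lin0 (lin _)).
by rewrite /vic_iota equiv //; apply: iota_mor.
Qed.

End ModuleMaps.
Lemma prism_map (k : pzRingType) (V : lmodType k) (G : Type) (q h h' : G -> G)
    (Psi : seq G -> V) X :
  (forall x, h' (q x) = q (h x)) -> prism h' Psi (map q X) = prism h (Psi \o map q) X.
Proof.
move=> hq; elim: X Psi => //= x X IHX Psi; rewrite IHX hq; congr (Psi (_ :: _ :: _) - _).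
by rewrite -!map_comp; apply: eq_map => z /=.
Qed.

(** * Maps out of free modules, and equivariant cochains on them *)

Section FreeMaps.
Variables (R : finPzRingType) (k : pzRingType) (d l : nat).
Local Notation F := (free_VIC R k d l).
Local Notation basis n := ('I_l * word R d n)%type.

Definition coef n (x : obj F n) (b : basis n) : k := (x : {ffun basis n -> k^o}) b.

Definition gen n (b : basis n) : obj F n := [ffun b' => (b' == b)%:R].

Lemma gen_act m n (f : 'M[R]_(n, m)) (g : 'M[R]_(m, n)) b :
  act f g (gen b) = gen (basis_act f g b) :> obj F n.
Proof.
apply/ffunP => b'; rewrite !ffunE; case: eqP => [->|ne].
  rewrite (bigD1 b) //= ffunE eqxx big1 ?addr0 // => b1 /andP[_ /negPf].
  by rewrite ffunE => ->.
by rewrite big1 // => b1 /eqP e; rewrite ffunE; case: eqP => // b1b; case: ne; rewrite -e b1b.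
Qed.

Lemma coef_lin n b : linear (fun x : obj F n => coef x b : k^o).
Proof. by move=> a x y; rewrite /coef !ffunE. Qed.

Lemma coef_gen n (b b' : basis n) : coef (gen b) b' = (b' == b)%:R.
Proof. by rewrite /coef ffunE. Qed.

Lemma genE n (x : obj F n) : x = \sum_b coef x b *: gen b.
Proof.
apply/ffunP => b; rewrite -[LHS]/(coef x b) -[RHS]/(coef _ b) (lin_sum (coef_lin b)).
rewrite (bigD1 b) //= big1 => [|b' b'b].
  by rewrite addr0 (linZ (coef_lin b)) coef_gen eqxx /GRing.scale /= mulr1.
by rewrite (linZ (coef_lin b)) coef_gen eq_sym (negPf b'b) scaler0.
Qed.

Section Extension.
Variables (M : VICmodule R k) (phi : forall n, basis n -> obj M n).

Definition free_map n (x : obj F n) : obj M n := \sum_b coef x b *: phi b.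

Lemma free_map_lin n : linear (@free_map n).
Proof.
move=> a x y; rewrite /free_map scaler_sumr -big_split; apply: eq_bigr => b _ /=.
by rewrite (coef_lin b a) scalerDl scalerA.
Qed.

Lemma free_map_gen n (b : basis n) : free_map (gen b) = phi b.
Proof.
rewrite /free_map (bigD1 b) //= coef_gen eqxx scale1r big1 ?addr0 // => b' /negPf.
by rewrite coef_gen => ->; rewrite scale0r.
Qed.

Lemma free_map_VIC :
  (forall m n (f : 'M[R]_(n, m)) g b, is_VICmor f g ->
    phi (basis_act f g b) = act f g (phi b)) ->
  VIC_map free_map.
Proof.
move=> phi_act; split=> [n|m n f g x fg]; first exact: free_map_lin.
rewrite {1}[x]genE (lin_sum (@act_lin R k F _ _ _ _ fg)) (lin_sum (@free_map_lin n)).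
rewrite (lin_sum (@act_lin R k M _ _ _ _ fg)); apply: eq_bigr => b _.
rewrite (linZ (@act_lin R k F _ _ _ _ fg)) (linZ (@free_map_lin n)) (linZ (@act_lin R k M _ _ _ _ fg)).
by rewrite gen_act free_map_gen phi_act.
Qed.

End Extension.

Lemma iota_inj n : injective (@vic_iota R k F n).
Proof.
have act_inj : injective (@basis_act R d l _ _ (iota_l R n) (iota_r R n)).
  move=> [r [A B]] [r' [A' B']] [-> eA eB]; congr (_, (_, _)).
    by rewrite -[A]mul1mx -[A']mul1mx -(iota_mor R n) -!mulmxA eA.
  by rewrite -[B]mulmx1 -[B']mulmx1 -(iota_mor R n) !mulmxA eB.
have iotaE (x : obj F n) b : coef (vic_iota x) (basis_act (iota_l R n) (iota_r R n) b) = coef x b.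
  by rewrite /coef ffunE (big_pred1 b) // => b'; rewrite /= (inj_eq act_inj).
by move=> x y e; apply/ffunP => b; rewrite -[LHS]iotaE -[RHS]iotaE e.
Qed.

Definition GLbasis n (g : GL R n) (b : basis n) : basis n := (b.1, GLword g b.2).

Lemma GLbasisK n (g : GL R n) : cancel (GLbasis g) (GLbasis g^-1%g).
Proof. by case=> r w; rewrite /GLbasis /= GLwordM mulVg GLword1. Qed.

Lemma GLbasisVK n (g : GL R n) : cancel (GLbasis g^-1%g) (GLbasis g).
Proof. by case=> r w; rewrite /GLbasis /= GLwordM mulgV GLword1. Qed.

Lemma GLact_invE_free n (g : GL R n) (x : obj F n) b : coef (GLact_inv g x) b = coef x (GLbasis g b).
Proof.
rewrite /coef ffunE (big_pred1 (GLbasis g b)) // => b'.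
exact: (can2_eq (GLbasisVK g) (GLbasisK g)).
Qed.

Section Descent.
Variables (V : lmodType k) (n p : nat) (Omega : basis n -> seq (GL R n) -> V).
Hypothesis Omega_inv : forall g b X, size X = p.+1 -> Omega (GLbasis g b) (map (mulg g) X) = Omega b X.

(** By invariance, translating [Y] to first vertex 1 does not change its pairing with [Omega]. *)
Lemma simplex_descent (Y : seq (GL R n)) (x : obj F n) : size Y = p.+1 ->
  \sum_v coef (simplex p Y x v.1) v.2 *: Omega v.2 (vertices v.1) =
  \sum_b coef x b *: Omega b Y.
Proof.
move=> sY; rewrite -(pair_bigA _ (fun s b => coef (simplex p Y x s) b *: Omega b (vertices s))) /=.
rewrite (bigD1 (differences p Y)) //= [X in _ + X]big1 ?addr0; last first.
  move=> s /negPf sd; rewrite big1 // => b _.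
  by rewrite /simplex /bar sd (lin0 (coef_lin b)) scale0r.
set g := nth 1%g Y 0; rewrite (reindex (GLbasis g^-1%g)) /=; last first.
  by exists (GLbasis g) => b _; rewrite ?GLbasisK ?GLbasisVK.
apply: eq_bigr => b _; rewrite /simplex /bar eqxx GLact_invE_free GLbasisVK.
by rewrite vertices_differences // (Omega_inv g^-1%g) ?GLbasisVK.
Qed.

(* Summing an equivariant cochain over a chain of the bar complex intertwines the
   coboundary with the boundary. *)
Lemma coboundary_descent (c : chain F n p.+1) :
  \sum_u coef (c u.1) u.2 *: coboundary (Omega u.2) (vertices u.1) =
  \sum_v coef (bnd c v.1) v.2 *: Omega v.2 (vertices v.1).
Proof.
transitivity (\sum_t \sum_(i < p.+2) (-1) ^+ i *:
   \sum_v coef (simplex p (delete i (vertices t)) (c t) v.1) v.2 *: Omega v.2 (vertices v.1)).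
  rewrite -(pair_bigA _ (fun t b => coef (c t) b *: coboundary (Omega b) (vertices t))) /=.
  apply: eq_bigr => t _; rewrite /coboundary size_vertices.
  under eq_bigr do rewrite scaler_sumr; rewrite exchange_big; apply: eq_bigr => i _.
  rewrite simplex_descent.
    by rewrite scaler_sumr; apply: eq_bigr => b _; rewrite !scalerA commr_sign.
  by apply/eqP; rewrite -eqSS size_delete size_vertices.
under eq_bigr do under eq_bigr do rewrite scaler_sumr.
under eq_bigr do rewrite exchange_big.
rewrite exchange_big; apply: eq_bigr => v _; rewrite bndE (lin_sum (coef_lin _)) scaler_suml.
apply: eq_bigr => t _; rewrite /coboundary size_vertices (lin_sum (coef_lin _)) scaler_suml.
by apply: eq_bigr => i _; rewrite (linZ (coef_lin _)) scalerA.
Qed.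

End Descent.

(** In degree 0 the coboundary is the value at the empty list, hence the hypothesis on [Omega b
    [::]]. *)
Lemma cycle_descent (V : lmodType k) n p (Omega : basis n -> seq (GL R n) -> V) (c : chain F n p) :
  (forall g b X, size X = p -> Omega (GLbasis g b) (map (mulg g) X) = Omega b X) ->
  (forall b, Omega b [::] = 0) -> is_cycle c ->
  \sum_u coef (c u.1) u.2 *: coboundary (Omega u.2) (vertices u.1) = 0.
Proof.
case: p c => [|p] c Omega_inv Omega0 cyc.
  rewrite big1 // => u _; rewrite /vertices /= coboundary_cons /coboundary.
  by rewrite big_ord0 Omega0 subrr scaler0.
rewrite coboundary_descent // big1 // => v _.
by rewrite cyc (lin0 (coef_lin _)) scale0r.
Qed.
End FreeMaps.
Arguments gen {R k d l n}.
Lemma bnd_prism (R : finPzRingType) (k : pzRingType) (M : VICmodule R k) n p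
    (h : GL R n -> GL R n) (Psi : seq (GL R n) -> chain M n p.+1) X s :
  bnd (fun s' => prism h (fun Y => Psi Y s') X) s = prism h (fun Y => bnd (Psi Y) s) X.
Proof.
elim: X Psi => [|x X IHX] Psi /=.
  have := bnd_sum (fun=> Psi [::]) (fun i : 'I_0 => 0) s; rewrite big_ord0; apply: etrans.
  by apply: eq_bnd => t; rewrite big_ord0.
rewrite -(IHX (fun Z => Psi (x :: Z))) -[RHS]addrC -scaleN1r -bnd_lin.
by apply: eq_bnd => t; rewrite scaleN1r [RHS]addrC.
Qed.

(** The two words show that the first column of [g] and the first row of its inverse are unit
    vectors; multiplying the inverse by [g] then clears the other off-diagonal blocks. *)
Lemma GLext_of_extend (R : finPzRingType) d n (g : GL R n.+1) (w w' : word R d n) :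
  extend w = GLword g (extend w') -> exists g', g = GLext g'.
Proof.
case=> e1 e2; have gV := GL_12 g; have Vg := GL_21 g.
have g1 := @submxK _ 1 n 1 n (val g).1; have g2 := @submxK _ 1 n 1 n (val g).2.
move: e1 e2 gV Vg; rewrite -g1 -g2.
set b := @ursubmx _ 1 n 1 n (val g).1 in g1 *; set e := @drsubmx _ 1 n 1 n (val g).1 in g1 *.
set c := @dlsubmx _ 1 n 1 n (val g).2 in g2 *; set e' := @drsubmx _ 1 n 1 n (val g).2 in g2 *.
rewrite (@mulmx_block R 1 n 1 n 1 d) !(mulmx0, mulmx1, add0r, addr0).
move/(@eq_block_mx _ 1 n 1 d) => [a1 _ c1 _]; rewrite -{}a1 -{}c1 in g1 *.
rewrite (@mulmx_block R 1 d 1 n 1 n) !(mul0mx, mul1mx, add0r, addr0).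
move/(@eq_block_mx _ 1 d 1 n) => [a2 b2 _ _]; rewrite -{}a2 -{}b2 in g2 *.
rewrite -[n.+1]/(1 + n)%N !(@mulmx_block R 1 n 1 n 1 n) scalar_mx_block.
rewrite !(mulmx0, mulmx1, mul0mx, mul1mx, add0r, addr0).
move/(@eq_block_mx _ 1 n 1 n) => [_ _ _ ee'].
move/(@eq_block_mx _ 1 n 1 n) => [_ b0 c0]; rewrite b0 mulmx0 add0r => e'e.
have gl : GLpred (e, e') by rewrite /GLpred /= ee' e'e !eqxx.
exists (exist (fun AB => GLpred AB) _ gl); apply: GL_eqP; first by rewrite -g1 b0.
by rewrite -g2 c0.
Qed.

(** * Restricted cycles are homologous to stabilized ones *)

Section ImageLemma.
Variables (R : finPzRingType) (k : pzRingType) (d l : nat).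
Local Notation F := (free_VIC R k d l).
Local Notation P := (free_VIC R k d.+1 l).
Local Notation basis n := ('I_l * word R d.+1 n)%type.

Definition restrict_word n (w : word R d.+1 n) : word R d n :=
  (w.1 *m iota_l R d, iota_r R d *m w.2).

Definition restrict_gen n (b : basis n) : obj F n :=
  if genuine b.2 then gen (b.1, restrict_word b.2) else 0.

(* Precomposition with the standard morphism [R^d] -> [R^(d+1)]; labels that are
   not VIC morphisms go to 0. *)
Definition restrict := free_map restrict_gen.

Lemma restrict_gen_act m n (f : 'M[R]_(n, m)) g b : is_VICmor f g ->
  restrict_gen (basis_act f g b) = act f g (restrict_gen b).
Proof.
move=> fg; rewrite /restrict_gen -[(basis_act f g b).2]/(word_act f g b.2).
rewrite genuine_act // (lin_if (act_lin fg)) gen_act.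
by rewrite /basis_act /word_act /restrict_word /= !mulmxA.
Qed.

Lemma restrict_VIC : VIC_map restrict.
Proof. exact: (free_map_VIC restrict_gen_act). Qed.

Lemma restrict_extend n (w : word R d n) :
  restrict_word (extend w) = word_act (iota_l R n) (iota_r R n) w.
Proof.
congr (_, _) => /=; rewrite /iota_l /iota_r.
  rewrite (@mul_block_col R 1 n 1 d d) (@mul_col_mx R 1 n n d).
  by rewrite !(mulmx0, mulmx1, mul0mx, mul1mx, add0r, addr0).
rewrite (@mul_row_block R d 1 d 1 n) (@mul_mx_row R d n 1 n).
by rewrite !(mulmx0, mulmx1, mul0mx, mul1mx, add0r, addr0).
Qed.

Variable n : nat.
Hypothesis large : (#|R| < n.+1)%N.

Lemma extension_frame : exists (gamma : word R d.+1 n.+1 -> GL R n.+1) (rho : word R d.+1 n.+1 -> word R d n),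
  forall w, genuine w -> w = GLword (gamma w) (extend (rho w)).
Proof.
have /choice[f fP] : forall w : word R d.+1 n.+1, exists gr : GL R n.+1 * word R d n,
    genuine w -> w = GLword gr.1 (extend gr.2).
  (* Labels that are not morphisms get a dummy value. *)
  move=> w; case: (boolP (genuine w)) => [gw|_]; last by exists (1%g, (0, 0)).
  by have [w' [g e] _] := orbit_extend gw large; exists (g, w').
by exists (fun w => (f w).1), (fun w => (f w).2).
Qed.

Lemma simplex_mulg (M : VICmodule R k) m p g X (x : obj M m) :
  size X = p.+1 -> simplex p (map (mulg g) X) (GLact g x) = simplex p X x.
Proof.
move=> sX; rewrite /simplex (nth_map 1%g) ?sX // !GLact_invE -GLactM invMg mulgKV.
congr (bar _ _); apply/ffunP => j; rewrite !ffunE.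
have jp := ltn_ord j.
rewrite !(nth_map 1%g) ?sX ?ltnS //; last exact: ltnW.
by rewrite invMg -mulgA mulKg.
Qed.

(** In a simplex with label [b], each vertex [x] moves to [y b x]. This is equivariant, so the prism
    gives a homotopy. The inverse of [y b x] brings [b] into extended form; hence successive new
    vertices differ by elements of GL_n, and the restricted label comes from [vic_iota]. *)
Theorem restrict_cycle p (c : chain P n.+1 p) : is_cycle c ->
  exists z : chain F n p, is_cycle z /\
  exists h : chain F n.+1 p.+1, forall s, restrict (c s) - stab z s = bnd h s.
Proof.
have [gamma [rho frame]] := extension_frame.
pose y (b : basis n.+1) (x : GL R n.+1) := (x * gamma (GLword x^-1 b.2))%g.
have yM g b x : y (GLbasis g b) (g * x)%g = (g * y b x)%g.
  by rewrite /y /= GLwordM invMg mulgKV -mulgA.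
pose phi := @restrict_gen n.+1.
have phi_act g b : phi (GLbasis g b) = GLact g (phi b).
  exact: (restrict_gen_act _ (GL_mor g)).
move=> cyc.
pose L (c : chain P n.+1 p) : chain F n.+1 p := fun s =>
  \sum_u coef (c u.1) u.2 *: simplex p (map (y u.2) (vertices u.1)) (phi u.2) s.
pose H : chain F n.+1 p.+1 := fun s =>
  \sum_u coef (c u.1) u.2 *: prism (y u.2) (fun Y => simplex p.+1 Y (phi u.2) s) (vertices u.1).
have LH s : bnd H s = L c s - restrict (c s).
  have -> : restrict (c s) = \sum_u coef (c u.1) u.2 *: simplex p (vertices u.1) (phi u.2) s.
    rewrite -(pair_bigA _ (fun t b => coef (c t) b *: simplex p (vertices t) (phi b) s)) /=.
    rewrite [LHS](chainE (fun t => restrict (c t))); apply: eq_bigr => t _.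
    rewrite (lin_sum (simplex_lin _ _)); apply: eq_bigr => b _.
    by rewrite (linZ (simplex_lin _ _)).
  (* The term left over by the homotopy formula: an equivariant coboundary summed over a cycle. *)
  have zero : \sum_u coef (c u.1) u.2 *:
      coboundary (prism (y u.2) (fun Y => simplex p Y (phi u.2) s)) (vertices u.1) = 0.
    pose Omega b X := prism (y b) (fun Y => simplex p Y (phi b) s) X.
    have Omega_inv g b X : size X = p -> Omega (GLbasis g b) (map (mulg g) X) = Omega b X.
      move=> sX; rewrite /Omega (prism_map (h := y b)); last exact: yM.
      by apply: eq_prism => Y; rewrite sX => sY /=; rewrite phi_act simplex_mulg.
    by apply: (cycle_descent (Omega := Omega)).
  rewrite bnd_sum -[RHS]subr0 -[X in _ = _ - X]zero /L -!sumrB; apply: eq_bigr => u _.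
  rewrite -!scalerBr bnd_prism; congr (_ *: _).
  rewrite (@eq_prism _ _ _ _ _ (coboundary (fun Y => simplex p Y (phi u.2) s))).
    by apply/(canRL (addrK _)); apply: prism_homotopy.
  by move=> Y; rewrite size_vertices => sY; rewrite bnd_simplex.
have yP b x : genuine b.2 ->
    GLword (y b x)^-1%g b.2 = extend (rho (GLword x^-1%g b.2)).
  move=> gb; rewrite /y invMg -GLwordM.
  have gv : genuine (GLword x^-1%g b.2) by rewrite genuine_act //; apply: GL_mor.
  by move: (GLword _ b.2) gv => v /frame {2}->; rewrite GLwordM mulVg GLword1.
have lift_simplex (t : {ffun 'I_p -> GL R n.+1}) b : exists z : chain F n p,
    forall s, stab z s = simplex p (map (y b) (vertices t)) (phi b) s.
  case: (boolP (genuine b.2)) => gb; last first.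
    exists (fun=> 0) => s; rewrite /stab big1.
      by rewrite /phi /restrict_gen (negPf gb) (lin0 (simplex_lin _ _)).
    by move=> t' _; rewrite (lin0 (@iota_lin R k F _)) (lin0 (bar_lin _ _)).
  pose X := vertices t.
  have sX : size X = p.+1 by rewrite size_vertices.
  have /choice[g gP] : forall j : 'I_p, exists g, differences p (map (y b) X) j = GLext g.
    move=> j; have jp := ltn_ord j; rewrite ffunE !(nth_map 1%g) ?sX ?ltnS //; last exact: ltnW.
    apply: (@GLext_of_extend R d n _ (rho (GLword (nth 1%g X j)^-1%g b.2))
      (rho (GLword (nth 1%g X j.+1)^-1%g b.2))).
    by rewrite -!yP // GLwordM mulgK.
  pose x0 := nth 1%g X 0.
  exists (bar [ffun j => g j] (gen (b.1, rho (GLword x0^-1%g b.2)))) => s.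
  rewrite stab_bar /simplex (nth_map 1%g) ?sX // GLact_invE; congr (bar _ _ s).
    by apply/ffunP => j; rewrite gP !ffunE.
  have gy : genuine (GLbasis (y b x0)^-1%g b).2 by rewrite genuine_act //; apply: GL_mor.
  rewrite /vic_iota gen_act -phi_act /phi /restrict_gen gy /basis_act -restrict_extend -yP //.
have /choice[z zP] : forall u : {ffun 'I_p -> GL R n.+1} * basis n.+1, exists z : chain F n p,
    forall s, stab z s = simplex p (map (y u.2) (vertices u.1)) (phi u.2) s.
  by move=> u; apply: lift_simplex.
pose Z : chain F n p := fun t => \sum_u coef (c u.1) u.2 *: z u t.
have ZL s : stab Z s = L c s.
  by rewrite /Z stab_sum; apply: eq_bigr => u _; rewrite zP.
have eZ s : restrict (c s) - stab Z s = bnd (fun s => - H s) s.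
  by rewrite bndN LH ZL opprB.
exists Z; split; last by exists (fun s => - H s).
(* Stabilization is injective on chains with free coefficients, so [Z] is a cycle because [stab Z]
   is one. *)
case: (p) (c) cyc (Z) (H) eZ => // q c' cyc' Z' H' eZ' s; apply: iota_inj.
rewrite -stab_image -bnd_stab (lin0 (@iota_lin R k F _)).
rewrite (@eq_bnd _ _ _ _ _ _ (fun s => restrict (c' s) - bnd (fun s => - H' s) s)); last first.
  by move=> s'; rewrite -eZ' subKr.
rewrite bndB bnd_bnd subr0 (bnd_map restrict_VIC) cyc'.
exact: (lin0 (proj1 restrict_VIC _)).
Qed.

End ImageLemma.
(** * Stability *)

Section Covers.
Variables (R : finPzRingType) (k : pzRingType).

(** [orbit_iota] lowers the degree by one as long as it exceeds [N]. *)
Lemma factor_word e N n (w : word R e n) : (#|{: 'rV[R]_e}| <= N)%N -> (N <= n)%N -> genuine w ->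
  exists (u : word R N n) (w' : word R e N),
    [/\ genuine u, genuine w' & w = word_act u.1 u.2 w'].
Proof.
move=> eN; have triv (v : word R e N) : genuine v ->
    exists (u : word R N N) (w' : word R e N), [/\ genuine u, genuine w' & v = word_act u.1 u.2 w'].
  move=> gv; exists (1%:M, 1%:M), v; split=> //; first by rewrite /genuine /= mulmx1.
  by case: v {gv} => A B; rewrite /word_act /= mul1mx mulmx1.
elim: n w => [|n IHn] w; first by rewrite leqn0 => /eqP N0; move: w; rewrite -N0.
case: (eqVneq N n.+1) => [Nn _|Nn]; first by move: w; rewrite -Nn.
rewrite leq_eqVlt (negPf Nn) => {}Nn gw.
have [|w1 [g ->] gw1] := orbit_iota gw; first exact: leq_ltn_trans Nn.
have [u [w' [gu gw' ->]]] := IHn w1 Nn gw1.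
exists (GLword g (word_act (iota_l R n) (iota_r R n) u)), w'; split=> //.
  by rewrite genuine_act ?genuine_act //; [apply: iota_mor|apply: GL_mor].
by rewrite /GLword /word_act /= !mulmxA.
Qed.

Variables (M : VICmodule R k) (d l : nat) (y : 'I_l -> obj M d).

Definition eval_gen n (b : 'I_l * word R d n) : obj M n :=
  if genuine b.2 then act b.2.1 b.2.2 (y b.1) else 0.

Definition eval := free_map eval_gen.

Lemma eval_VIC : VIC_map eval.
Proof.
apply: free_map_VIC => m n f g b fg; rewrite /eval_gen -[(basis_act f g b).2]/(word_act f g b.2).
rewrite genuine_act // (lin_if (act_lin fg)); case: ifP => // /eqP gb.
by rewrite act_comp.
Qed.

(** The cover factors through the free module in degree [d], so that [restrict_cycle] applies. *)
Definition cover_map n (x : obj (free_VIC R k d.+1 l) n) : obj M n := eval (restrict x).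

Lemma VIC_map_comp (M1 M2 M3 : VICmodule R k) (f : forall n, obj M1 n -> obj M2 n)
    (g : forall n, obj M2 n -> obj M3 n) :
  VIC_map f -> VIC_map g -> VIC_map (fun n x => g n (f n x)).
Proof.
move=> [f_lin f_act] [g_lin g_act]; split=> [n a u v|m n h h' x hh].
  by rewrite f_lin g_lin.
by rewrite f_act // g_act.
Qed.

Lemma cover_VIC : VIC_map cover_map.
Proof. exact: (VIC_map_comp (@restrict_VIC R k d l) eval_VIC). Qed.

Lemma cover_gen n (u : word R d.+1 n) r : genuine u ->
  cover_map (gen (r, u)) = act u.1 u.2 (vic_iota (y r)).
Proof.
move=> gu; rewrite /cover_map /restrict free_map_gen /restrict_gen gu /eval free_map_gen.
have gr : genuine (restrict_word u).
  by rewrite /genuine /= mulmxA -(mulmxA _ u.2) (eqP gu) mulmx1 iota_mor.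
by rewrite /eval_gen gr /vic_iota -act_comp //; [apply: iota_mor|apply/eqP].
Qed.

Variable K : forall n, obj M n -> Prop.
Hypotheses (subK : VICsubmodule K) (Ky : forall r, K (y r)).

Lemma eval_in n (x : obj (free_VIC R k d l) n) : K (eval x).
Proof.
apply: (submodule_sum (VICsubmodule_submodule n subK)) => b _.
apply: (submoduleZ (VICsubmodule_submodule n subK)); rewrite /eval_gen.
case: ifP => [/eqP gb|_]; last exact: (submodule0 (VICsubmodule_submodule n subK)).
by case: subK => _ _; apply.
Qed.

Lemma cover_cycle n p (c : chain (free_VIC R k d.+1 l) n.+1 p) : (#|R| < n.+1)%N -> is_cycle c ->
  exists z : chain M n p, [/\ valued K z, is_cycle z &
    exists2 b : chain M n.+1 p.+1, valued K b & forall s, cover_map (c s) - stab z s = bnd b s].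
Proof.
move=> large /(restrict_cycle large)[z [cz [h hP]]].
exists (fun t => eval (z t)); split; first by move=> t; apply: eval_in.
  exact: (is_cycle_map eval_VIC).
exists (fun t => eval (h t)); first by move=> t; apply: eval_in.
move=> s; rewrite (bnd_map eval_VIC) -hP (stab_map eval_VIC).
by rewrite (linB (proj1 eval_VIC _)).
Qed.

End Covers.

Section Presentation.
Variables (R : finPzRingType) (k : pzRingType) (M : VICmodule R k).
Variable K : forall n, obj M n -> Prop.
Hypotheses (subK : VICsubmodule K) (fgK : fg_sub K).

(** The [y] are the images of the generators under all morphisms to degree [d]. A morphism to a
    degree above [d] factors through degree d + 1, and there, up to GL_(d+1), through the standard
    inclusion of degree [d]. *)
Lemma cover_exists : exists (d l : nat) (y : 'I_l -> obj M d), (forall r, K (y r)) /\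
  forall n x, (d < n)%N -> K x -> exists v, x = cover_map y v :> obj M n.
Proof.
have [J [e [x [Kx gen_x]]]] := fgK.
(* Large enough for the pigeonhole principle to apply to every generator in all degrees above
   [d]. *)
pose d := \max_j #|{: 'rV[R]_(e j)}|.
pose I := {j : J & word R (e j) d}.
pose y (r : 'I_#|{: I}|) : obj M d := let i := enum_val r in
  if genuine (tagged i) then act (tagged i).1 (tagged i).2 (x (tag i)) else 0.
have Ky r : K (y r).
  rewrite /y /=; case: ifP => [/eqP g|_].
    by case: subK => _ _; apply.
  exact: (submodule0 (VICsubmodule_submodule d subK)).
exists d, #|{: I}|, y; split=> // n z dn Kz.
(* The span of the images of the generators, as the intersection of all submodules containing
   them. *)
pose N m (z : obj M m) := forall S : obj M m -> Prop, is_submodule S ->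
  (forall j (w : word R (e j) m), genuine w -> S (act w.1 w.2 (x j))) -> S z.
have subN : VICsubmodule N.
  split=> [m S subS _|m a u v Nu Nv S subS Sx|m m' f g u fg Nu S subS Sx].
  - exact: (submodule0 subS).
  - by case: (subS) => _; apply; [apply: Nu|apply: Nv].
  - apply: (Nu (fun v => S (act f g v))).
      split=> [|a v v' Sv Sv']; first by rewrite (lin0 (act_lin fg)); apply: (submodule0 subS).
      by rewrite (act_lin fg) //; case: subS => _; apply.
    move=> j w gw; rewrite -act_comp //; last exact/eqP.
    by apply: (Sx j (word_act f g w)); rewrite genuine_act.
have Nx j : N (e j) (x j).
  move=> S subS Sx; rewrite -[x j]act_id; apply: (Sx j (1%:M, 1%:M)).
  by rewrite /genuine /= mulmx1.
have lin := proj1 (cover_VIC y) n.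
apply: (gen_x N subN Nx n z Kz (fun z => exists v, z = cover_map y v)).
  split; first by exists 0; rewrite (lin0 lin).
  by move=> a _ _ [u ->] [v ->]; exists (a *: u + v); rewrite lin.
move=> j w gw.
have ed : (#|{: 'rV[R]_(e j)}| <= d)%N by apply: (leq_bigmax j).
have [u [w1 [gu gw1 ->]]] := factor_word (leqW ed) dn gw.
have [|w2 [g ->] gw2] := orbit_iota gw1; first by rewrite ltnS.
pose u' : word R d.+1 n := word_act u.1 u.2 (val g).
have gu' : genuine u' by rewrite genuine_act; [apply/eqP/GL_21|apply/eqP].
exists (gen (enum_rank (existT _ j w2 : I), u')).
have gi : genuine (word_act (iota_l R d) (iota_r R d) w2) by rewrite genuine_act //; apply: iota_mor.
rewrite cover_gen // /y enum_rankK /= gw2 /vic_iota.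
rewrite -(act_comp (eqP gw2) (iota_mor R d)) -(act_comp (eqP gi) (eqP gu')).
by congr (act _ _ _); rewrite /= !mulmxA.
Qed.

End Presentation.

(** * Induction on the homological degree *)

Section Stability.
Variables (R : finPzRingType) (k : pzRingType).

Section Definitions.
Variables (M : VICmodule R k) (K : forall n, obj M n -> Prop).

Definition boundary_in n p (c : chain M n p) :=
  exists2 b : chain M n p.+1, valued K b & forall s, bnd b s = c s.

Definition stab_surjective p n := forall z : chain M n.+1 p, valued K z -> is_cycle z ->
  exists z' : chain M n p, [/\ valued K z', is_cycle z' & boundary_in (fun s => z s - stab z' s)].

Definition stab_injective p n := forall z : chain M n p, valued K z -> is_cycle z ->
  boundary_in (stab z) -> boundary_in z.

Hypothesis subK : VICsubmodule K.

Lemma eq_boundary_in n p (c c' : chain M n p) : c =1 c' -> boundary_in c -> boundary_in c'.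
Proof. by move=> e [b Kb bc]; exists b => // s; rewrite bc e. Qed.

Lemma boundary_in_lin n p a (c c' : chain M n p) :
  boundary_in c -> boundary_in c' -> boundary_in (fun s => a *: c s + c' s).
Proof.
move=> [b Kb bc] [b' Kb' bc']; exists (fun t => a *: b t + b' t); first exact: valued_lin.
by move=> s; rewrite bnd_lin bc bc'.
Qed.

Lemma is_cycle0 n p : is_cycle ((fun=> 0) : chain M n p).
Proof.
case: p => // p s; rewrite -[RHS](scale0r (bnd ((fun=> 0) : chain M n p.+1) s)) -bndZ.
by apply: eq_bnd => t; rewrite scale0r.
Qed.

Lemma boundary_in0 n p : boundary_in ((fun=> 0) : chain M n p).
Proof.
exists (fun=> 0) => [t|s]; first exact: (submodule0 (VICsubmodule_submodule n subK)).
exact: (is_cycle0 n p.+1).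
Qed.

Lemma boundary_inD n p (c c' : chain M n p) :
  boundary_in c -> boundary_in c' -> boundary_in (fun s => c s + c' s).
Proof. by move=> bc /(boundary_in_lin 1 bc); apply: eq_boundary_in => s; rewrite scale1r. Qed.

Lemma boundary_inB n p (c c' : chain M n p) :
  boundary_in c -> boundary_in c' -> boundary_in (fun s => c s - c' s).
Proof.
move=> bc bc'; have := boundary_in_lin (-1) bc' bc.
by apply: eq_boundary_in => s; rewrite scaleN1r addrC.
Qed.

Lemma boundary_in_stab n p (c : chain M n p) : boundary_in c -> boundary_in (stab c).
Proof.
move=> [b Kb bc]; exists (stab b); first exact: valued_stab.
by move=> s; rewrite bnd_stab; apply: eq_stab.
Qed.

Lemma stabB n p (c c' : chain M n p) s : stab (fun t => c t - c' t) s = stab c s - stab c' s.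
Proof.
rewrite -[- stab c' s]scaleN1r addrC -stab_lin; apply: eq_stab => t.
by rewrite scaleN1r addrC.
Qed.

Lemma stabD n p (c c' : chain M n p) s : stab (fun t => c t + c' t) s = stab c s + stab c' s.
Proof. by rewrite -[stab c s]scale1r -stab_lin; apply: eq_stab => t; rewrite scale1r. Qed.

End Definitions.

Definition stable_in p := forall (M : VICmodule R k) (K : forall n, obj M n -> Prop),
  VICsubmodule K -> fg_sub K ->
  exists N, forall n, (N <= n)%N -> stab_surjective K p n /\ stab_injective K p n.

Hypothesis noeth : left_noetherian k.

Lemma stab_surjective_step p : (forall q, p = q.+1 -> stable_in q) ->
  forall (M : VICmodule R k) (K : forall n, obj M n -> Prop),
  VICsubmodule K -> fg_sub K -> exists N, forall n, (N <= n)%N -> stab_surjective K p n.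
Proof.
move=> IH M K subK /(cover_exists subK)[d [l [y [Ky coverK]]]].
pose P := free_VIC R k d.+1 l.
have coverM := cover_VIC y; have lin n := proj1 coverM n.
have lift n q (z : chain M n q) : (d < n)%N -> valued K z ->
    exists c : chain P n q, forall t, z t = cover_map y (c t).
  by move=> dn Kz; have /choice[c cP] := fun t => coverK n (z t) dn (Kz t); exists c.
have cover_in n (x : obj P n) : K n (cover_map y x) by apply: eval_in.
case: p IH => [_|q /(_ q erefl) IH].
  (* Every 0-chain is a cycle, so a lift of [z] goes directly into [cover_cycle]. *)
  exists (maxn d #|R|) => n; rewrite geq_max => /andP[dn Rn] z Kz cz.
  have [c cE] := lift _ _ z dn Kz.
  have [z' [Kz' cz' [b Kb bE]]] := cover_cycle subK Ky (c := c) Rn I.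
  by exists z'; split=> //; exists b => // s; rewrite -bE cE.
pose K' n (x : obj P n) := cover_map y x = 0.
have subK' : VICsubmodule K'.
  split=> [n|n a u v|m n f g u fg]; rewrite /K'; first exact: (lin0 (lin n)).
    by move=> u0 v0; rewrite lin u0 v0 scaler0 addr0.
  by move=> u0; rewrite (proj2 coverM) // u0 (lin0 (act_lin fg)).
have subT : VICsubmodule (fun n (x : obj P n) => True) by [].
have [N1 st1] := IH P K' subK' (free_noetherian noeth subK').
have [N2 st2] := IH P _ subT (free_noetherian noeth subT).
exists (maxn (maxn d #|R|) (maxn N1 N2)) => n.
rewrite !geq_max => /andP[/andP[dn Rn] /andP[/st1[surj _] /st2[_ inj]]] z Kz cz.
have [c cE] := lift _ _ z dn Kz.
(* The connecting homomorphism: the boundary of a lift is a cycle with values in the kernel. *)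
have bz s : cover_map y (bnd c s) = 0.
  by rewrite -(bnd_map coverM) -[RHS](cz s); apply: eq_bnd => t.
have [w [Kw cw [b Kb bE]]] := surj (bnd c) bz (is_cycle_bnd c).
(* In the free module [stab w] is the boundary of c - b, so injectivity there makes [w] a
   boundary. *)
have [|c' _ c'E] := inj w (fun=> I) cw.
  by exists (fun t => c t - b t) => // s; rewrite bndB bE subKr.
(* The corrected lift is a cycle. The cover kills [b], and sends [c'] to a cycle because [w] lies in
   the kernel. *)
pose u s := c s - b s - stab c' s.
have cu : is_cycle u.
  move=> s; rewrite /u bndB bndB bE subKr bnd_stab.
  by rewrite (eq_stab _ c'E) subrr.
have [z2 [Kz2 cz2 [b2 Kb2 b2E]]] := cover_cycle subK Ky Rn cu.
exists (fun t => cover_map y (c' t) + z2 t); split.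
- by move=> t; apply: (submoduleD (VICsubmodule_submodule n subK)).
- move=> s; rewrite bndD cz2 addr0 (bnd_map coverM) c'E; exact: Kw.
exists b2 => // s; rewrite -b2E /u !(linB (lin _)) -cE (Kb s) subr0.
by rewrite stabD (stab_map coverM) opprD addrA.
Qed.

(** Each leading coefficient ideal becomes constant, and the finitely many positions share a common
    stage. *)
Lemma submodule_acc (W : finType) (S : nat -> {ffun W -> k^o} -> Prop) :
  (forall n, is_submodule (S n)) -> (forall n v, S n v -> S n.+1 v) ->
  exists N, forall n, (N <= n)%N -> forall v, S n v -> S N v.
Proof.
move=> subS incS; pose key := @enum_rank W.
have mono := increasing_mono incS.
have /choice[N hN] : forall w, exists N, forall n, (N <= n)%N -> forall c,
    leading_coef key (S n) w c -> leading_coef key (S N) w c.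
  move=> w; apply: (left_noetherian_acc noeth) => [n|n c [x [Sx xw x0]]].
    exact: leading_coef_ideal.
  by exists x; split=> //; apply: incS.
pose N0 := (\max_w N w)%N.
have leN w : (N w <= N0)%N by apply: leq_bigmax.
exists N0 => n Nn; apply: (leading_coef_sub (enum_rank_inj : injective key)) => //.
  by move=> v; apply: mono.
move=> w c /(hN w n (leq_trans (leN w) Nn))[x [Sx xw x0]].
by exists x; split=> //; apply: mono Sx.
Qed.

Section Injective.
Variables (M : VICmodule R k) (K : forall n, obj M n -> Prop) (p N0 : nat).
Hypotheses (subK : VICsubmodule K) (fgK : fg_sub K).
Hypothesis surj : forall n, (N0 <= n)%N -> stab_surjective K p n.

Fixpoint stab_iter N m (c : chain M N p) : chain M (m + N) p :=
  match m return chain M (m + N) p with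
  | 0 => c
  | m'.+1 => stab (@stab_iter N m' c)
  end.
Arguments stab_iter {N} m c.

Lemma stab_iter_lin N m a (c c' : chain M N p) s :
  stab_iter m (fun t => a *: c t + c' t) s = a *: stab_iter m c s + stab_iter m c' s.
Proof. by elim: m s => //= m IHm s; rewrite -stab_lin; apply: eq_stab. Qed.

Lemma stab_iter0 N m s : stab_iter m ((fun=> 0) : chain M N p) s = 0.
Proof.
elim: m s => //= m IHm s; rewrite /stab big1 // => t _.
by rewrite IHm (lin0 (@iota_lin R k M _)) (lin0 (bar_lin _ _)).
Qed.

Lemma stab_iter_surjective N m (z : chain M (m + N) p) : (N0 <= N)%N -> valued K z -> is_cycle z ->
  exists z0 : chain M N p, [/\ valued K z0, is_cycle z0 & boundary_in K (fun s => z s - stab_iter m z0 s)].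
Proof.
move=> NN; elim: m z => [|m IHm] z Kz cz.
  exists z; split=> //; apply: eq_boundary_in (boundary_in0 subK _ _) => s.
  by rewrite subrr.
have [z1 [Kz1 cz1 bz1]] := surj (leq_trans NN (leq_addl m N)) Kz cz.
have [z0 [Kz0 cz0 bz0]] := IHm z1 Kz1 cz1; exists z0; split=> //.
have := boundary_inD subK bz1 (boundary_in_stab subK bz0).
by apply: eq_boundary_in => s; rewrite stabB addrA subrK.
Qed.

Lemma stab_eventually_injective : exists N, forall n, (N <= n)%N -> stab_injective K p n.
Proof.
have [d [l [y [Ky coverK]]]] := cover_exists subK fgK.
(* From degree [N] on surjectivity holds, and the chains in degree [N] are covered by a finite free
   k-module, where the chain condition applies. *)
pose N := maxn N0 d.+1.
have NN : (N0 <= N)%N by apply: leq_maxl.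
have dN : (d < N)%N by apply: leq_maxr.
pose B := ('I_l * word R d.+1 N)%type.
pose W : finType := ({ffun 'I_p -> GL R N} * B)%type.
pose ch (v : {ffun W -> k^o}) : chain M N p := fun t =>
  cover_map y ([ffun b => v (t, b)] : obj (free_VIC R k d.+1 l) N).
have ch_lin a v v' t : ch (a *: v + v') t = a *: ch v t + ch v' t.
  rewrite -(proj1 (cover_VIC y) N) /ch; congr (cover_map y _).
  by apply/ffunP => b; rewrite !ffunE.
have ch_onto (z : chain M N p) : valued K z -> exists v, z =1 ch v.
  move=> Kz; have /choice[c cP] := fun t => coverK N (z t) dN (Kz t).
  exists [ffun u : W => (c u.1 : {ffun B -> k^o}) u.2] => t; rewrite cP /ch; congr (cover_map y _).
  by apply/ffunP => b; rewrite !ffunE.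
(* The vectors whose cycle dies after [m] stabilizations. *)
pose S m v := is_cycle (ch v) /\ boundary_in K (stab_iter m (ch v)).
have subS m : is_submodule (S m).
  split=> [|a v v' [cv bv] [cv' bv']].
    have ch0 : ch 0 = (fun=> 0).
      by apply/funext => t; have := ch_lin (-1) 0 0 t; rewrite scaler0 addr0 scaleN1r addNr.
    rewrite /S ch0; split; first exact: is_cycle0.
    by apply: eq_boundary_in (boundary_in0 subK _ _) => s; rewrite stab_iter0.
  rewrite /S; have -> : ch (a *: v + v') = (fun t => a *: ch v t + ch v' t) by apply/funext => t.
  split; first exact: is_cycle_lin.
  apply: eq_boundary_in (boundary_in_lin subK a bv bv') => s.
  by rewrite stab_iter_lin.
have incS m v : S m v -> S m.+1 v by move=> [cv /(boundary_in_stab subK)].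
have [m0 stabS] := submodule_acc subS incS.
exists (m0 + N)%N => n mn z Kz cz bz.
have [m en] : exists m, n = (m + N)%N.
  by exists (n - N)%N; rewrite subnK // (leq_trans _ mn) // leq_addl.
move: mn z Kz cz bz; rewrite en leq_add2r => {n en} m0m z Kz cz bz.
(* Up to a boundary [z] comes from degree [N], where dying after m + 1 steps implies dying after
   [m0] steps, hence after [m]. *)
have [z0 [Kz0 cz0 bz0]] := stab_iter_surjective NN Kz cz.
have [v vE] := ch_onto z0 Kz0; have {vE} ev : z0 = ch v by apply/funext.
have [_ bv] : S m0 v.
  apply: (stabS m.+1); first exact: leqW.
  split; first by rewrite -ev.
  have := boundary_inB subK bz (boundary_in_stab subK bz0).
  by apply: eq_boundary_in => s; rewrite stabB subKr -ev.
have bm : boundary_in K (stab_iter m (ch v)).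
  by rewrite -(subnK m0m); elim: (m - m0)%N => //= j /(boundary_in_stab subK).
rewrite -ev in bm; have := boundary_inD subK bz0 bm.
by apply: eq_boundary_in => s; rewrite subrK.
Qed.

End Injective.

Theorem homology_stable p : stable_in p.
Proof.
have step q : (forall r, q = r.+1 -> stable_in r) -> stable_in q.
  move=> IH M K subK fgK; have [N1 surj] := stab_surjective_step IH subK fgK.
  have [N2 inj] := stab_eventually_injective subK fgK surj.
  by exists (maxn N1 N2) => n; rewrite geq_max => /andP[/surj s /inj].
by elim: p => [|p IHp]; apply: step => // r [<-].
Qed.

End Stability.

Theorem theoremB (R : finPzRingType) (k : pzRingType) (M : VICmodule R k) :
  left_noetherian k -> VIC_fg M ->
  forall p : nat, exists N : nat, forall n : nat, (N <= n)%N ->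
    homology_iso M p n n.+1.
Proof.
move=> noeth [l [d [x gen_x]]] p.
pose K n (y : obj M n) := True.
have subK : VICsubmodule K by [].
have fgK : fg_sub K.
  by exists 'I_l, d, x; split=> // N subN Nx n y _; apply: gen_x.
have [N st] := @homology_stable R k noeth p M K subK fgK.
exists N => n /st[surj inj]; exists (@stab R k M n p); split.
- exact: is_cycle_stab.
- by move=> a z1 z2 _ _ s; apply: stab_lin.
- by move=> z _ [b bz]; have [|c _ cE] := boundary_in_stab subK (c := z); [exists b|exists c].
- by move=> z cz [b bz]; have [|c _ cE] := inj z (fun=> I) cz; [exists b|exists c].
- move=> z' cz'; have [z [_ cz [b _ bE]]] := surj z' (fun=> I) cz'.
  by exists z => //; exists b.
Qed.
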